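(* Let $n$ be an integer with $5\nmid n$, and let $f_n$, $\rho$, $K_n$, $\sigma$, $\rho^{(i)}$, $\Delta_n$, $a,b,c,d,e$, $\zeta$, $A_n,B_n,C_n$ and $u_\lambda$ be as in the context. Define elements $\alpha_1,\alpha_2,\alpha_3\in\mathbb Z[\zeta]$ as follows. (1) Write $bc^2d^3e^3=p_1\cdots p_k$ with $p_1,\dots,p_k$ (not necessarily distinct) prime numbers; for each $i$ let $\pi_i$ be a prime element of $\mathbb Z[\zeta]$ dividing both $p_i$ and $A_n$ (such prime elements exist); put $\lambda_1=\prod_{i=1}^k\pi_i$ and $\alpha_1=u_{\lambda_1}\lambda_1$. (2) Write $bcd^2e^2=q_1\cdots q_r$ with $q_j$ (not necessarily distinct) primes; for each $j$ let $\pi'_j$ be a prime element of $\mathbb Z[\zeta]$ dividing both $q_j$ and $B_n$ (such exist); put $\lambda_2=\prod_j\pi'_j$ and $\alpha_2=u_{\lambda_2}\lambda_2$. (3) Write $cde=s_1\cdots s_w$ with $s_j$ (not necessarily distinct) primes; for each $j$ let $\pi''_j$ be a prime element of $\mathbb Z[\zeta]$ dividing both $s_j$ and $C_n$ (such exist); put $\lambda_3=\prod_j\pi''_j$ and $\alpha_3=u_{\lambda_3}\lambda_3$. Write $\alpha_1\alpha_2\alpha_3=\beta_0+\beta_1\zeta+\beta_2\zeta^2+\beta_3\zeta^3$ with $\beta_0,\beta_1,\beta_2,\beta_3\in\mathbb Z$, and put $$m:=\frac15\left(\left(\frac n5\right)bc^2d^3e^4-n^2(\beta_0+\beta_1+\beta_2+\beta_3)\right).$$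 Then $m\in\mathbb Z$, and $$\frac{1}{bc^2d^3e^4}\left(\beta_0\rho+\beta_1\rho^{(1)}+\beta_2\rho^{(2)}+\beta_3\rho^{(3)}-m\right)$$ is a generator of a normal integral basis of $K_n$.
   Context: For an integer $n$, let $f_n(X)=X^5+n^2X^4-(2n^3+6n^2+10n+10)X^3+(n^4+5n^3+11n^2+15n+5)X^2+(n^3+4n^2+10n+10)X+1$ (Emma Lehmer's quintic; it is irreducible over $\mathbb Q$). Let $\rho$ be a root of $f_n$ and $K_n=\mathbb Q(\rho)$, a cyclic quintic field with ring of integers $\mathcal O_{K_n}$. Let $\sigma$ be the generator of $\mathrm{Gal}(K_n/\mathbb Q)$ with $\sigma(\rho)=\frac{n+2+n\rho-\rho^2}{1+(n+2)\rho}$, and write $\rho^{(i)}=\sigma^i(\rho)$ for $i\in\mathbb Z/5\mathbb Z$. Let $\Delta_n=n^4+5n^3+15n^2+25n+25$ and write $\Delta_n=ab^2c^3d^4e^5$ with $a,b,c,d,e$ positive integers, $a,b,c,d$ square-free and pairwise coprime. $\left(\frac n5\right)$ is the Legendre symbol. Let $\zeta$ be a primitive fifth root of unity and $A_n=n+2+2\zeta^4+\zeta^2$, $B_n=n+2+2\zeta^2+\zeta$, $C_n=n+2+2\zeta^3+\zeta^4$. For $\lambda\in\mathbb Z[\zeta]$ with $\lambda\notin(1-\zeta)$, the residue of $\lambda$ modulo $(1-\zeta)$ is one of $1,-1,2,-2$, and $u_\lambda\in\mathbb Z[\zeta]^\times$ is defined to be $1$, $-1$, $\frac{1+\sqrt5}{2}$,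 $-\frac{1+\sqrt5}{2}$ respectively ($\sqrt5\in\mathbb Z[\zeta]$, computed inside $\mathbb C$). An element $\alpha\in K_n$ is a generator of a normal integral basis if $\{\alpha,\sigma(\alpha),\sigma^2(\alpha),\sigma^3(\alpha),\sigma^4(\alpha)\}$ is a $\mathbb Z$-basis of $\mathcal O_{K_n}$. *)

(* Defs.v *)
From mathcomp Require Export all_boot all_order all_algebra.
From mathcomp Require Export all_fingroup all_solvable all_field.
From mathcomp Require Import boolp.

Set Implicit Arguments.
Unset Strict Implicit.
Unset Printing Implicit Defensive.

Import GRing.Theory Num.Theory.
Local Open Scope ring_scope.

Definition lehmer_quintic (n : int) : {poly int} :=
  'X^5 + (n ^+ 2)%:P * 'X^4
  - (2 * n ^+ 3 + 6 * n ^+ 2 + 10 * n + 10)%:P * 'X^3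
  + (n ^+ 4 + 5 * n ^+ 3 + 11 * n ^+ 2 + 15 * n + 5)%:P * 'X^2
  + (n ^+ 3 + 4 * n ^+ 2 + 10 * n + 10)%:P * 'X + 1.

Definition lehmer_Delta (n : int) : int :=
  n ^+ 4 + 5 * n ^+ 3 + 15 * n ^+ 2 + 25 * n + 25.

Definition squarefree (m : nat) : Prop :=
  forall k : nat, (k ^ 2 %| m)%N -> k = 1%N.

(* The Legendre symbol (x / p), for p an odd prime. *)
Definition legendre (x : int) (p : nat) : int :=
  if (p %| x)%Z then 0
  else if [exists y : 'I_p, (Posz y ^+ 2 == x %[mod p])%Z] then 1
  else -1.

Section Zzeta.

Variable zeta : algC.

Definition Zzeta (x : algC) : Prop :=
  exists p : {poly int}, x = (map_poly intr p).[zeta].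

(* Divisibility in the ring Z[zeta]: the quotient must lie in Z[zeta]. *)
Definition Zzeta_dvd (x y : algC) : Prop :=
  exists2 q : algC, Zzeta q & y = x * q.

Definition Zzeta_unit (x : algC) : Prop :=
  Zzeta x /\ Zzeta_dvd x 1.

Definition Zzeta_prime (x : algC) : Prop :=
  [/\ Zzeta x, x <> 0, ~ Zzeta_unit x
    & forall y z : algC, Zzeta y -> Zzeta z ->
        Zzeta_dvd x (y * z) -> Zzeta_dvd x y \/ Zzeta_dvd x z].

Definition Zzeta_residue (lam r : algC) : Prop :=
  Zzeta_dvd (1 - zeta) (lam - r).

(* The value 0 is a junk value, reached only when lam is in (1 - zeta) (or
   not in Z[zeta]). [sqrtC 5] is the positive real square root. *)
Definition u_ (lam : algC) : algC :=
  if `[< Zzeta_residue lam 1 >] then 1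
  else if `[< Zzeta_residue lam (-1) >] then -1
  else if `[< Zzeta_residue lam 2 >] then (1 + sqrtC 5) / 2
  else if `[< Zzeta_residue lam (-2) >] then - ((1 + sqrtC 5) / 2)
  else 0.

Definition common_prime_divisor (p : nat) (x pi : algC) : Prop :=
  [/\ Zzeta_prime pi, Zzeta_dvd pi p%:R & Zzeta_dvd pi x].

(* N = p_0 ... p_(k-1) with p_i prime numbers, and pi_i is a prime element of
   Z[zeta] dividing both p_i and x. *)
Definition prime_element_choice (N : nat) (x : algC)
    (k : nat) (p : 'I_k -> nat) (pi : 'I_k -> algC) : Prop :=
  [/\ N = (\prod_(i < k) p i)%N, forall i, prime (p i)
    & forall i, common_prime_divisor (p i) x (pi i)].

Definition A_ (n : int) : algC := n%:~R + 2 + 2 * zeta ^+ 4 + zeta ^+ 2.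
Definition B_ (n : int) : algC := n%:~R + 2 + 2 * zeta ^+ 2 + zeta.
Definition C_ (n : int) : algC := n%:~R + 2 + 2 * zeta ^+ 3 + zeta ^+ 4.

End Zzeta.

Definition is_Z_basis (V : zmodType) (M : V -> Prop) (k : nat)
    (v : 'I_k -> V) : Prop :=
  [/\ forall i, M (v i),
      forall x, M x -> exists c : 'I_k -> int, x = \sum_(i < k) v i *~ c i
    & forall c : 'I_k -> int,
        \sum_(i < k) v i *~ c i = 0 -> forall i, c i = 0].

Definition ring_of_integers (L : fieldExtType rat) (x : L) : Prop :=
  integralOver (intr : int -> L) x.

Definition normal_integral_basis_generator (L : splittingFieldType rat)
    (sigma : gal_of {:L}) (alpha : L) : Prop :=
  is_Z_basis (@ring_of_integers L) (fun i : 'I_5 => (sigma ^+ i)%g alpha).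

(* Main.v *)
(* Write tau(x) = sum_j sigma^j(x) zeta^-j for the resolvent of x in K_n.  The
   orbit of rho satisfies bilinear relations over Z[n], and these give
   tau(rho) * conj(tau(rho)) = Delta_n and tau(rho)^5 = - A B^2 C^3 D^4, where
   A = A_n, B = B_n, C = C_n and D are the conjugates of A_n.  As
   5 zeta = n^3 + 4n^2 + 10n + 10 modulo A_n, a prime p dividing Delta_n splits
   completely, and each of A, B, C, D is divisible by exactly one of the four
   primes above p.  Hence for the element alpha of the theorem the number
   theta = tau(alpha)^5 lies in Z[zeta] and is not divisible by the fifth power
   of a prime above Delta_n.

   Integrality of theta makes 5 alpha integral, and so is M alpha with M prime
   to 5; hence alpha is integral.  Conversely, if x is integral and
   x = sum_j c_j sigma^j(alpha) with c_j rational, then c = sum_j c_j zeta^j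
   satisfies c^5 theta = tau(x)^5, which is integral, so that c is in Z[zeta];
   together with the trace of x and the denominators allowed by a dual element,
   this forces c_j to be integers.  Existence of prime elements above p comes
   from the Euclidean algorithm in Z[zeta]. *)

From HB Require Import structures.
From mathcomp Require Import boolp ring lra zify.
Require Import Defs.

Set Implicit Arguments.
Unset Strict Implicit.
Unset Printing Implicit Defensive.

Import Order.TTheory GRing.Theory Num.Theory.
Local Open Scope ring_scope.

(** * Arithmetic of Z[zeta] *)

(** The exponents in the statement come from rounding. If p^l exactly divides Delta_n, the fifth
    power of the resolvent of rho has valuations l, 2l, 3l, 4l at the four primes above p, and
    floor(j l / 5) fifth powers can be removed at the j-th of them. Dividing by a rational integer
    removes the same amount at all four: M takes floor(4 l / 5), and alpha_1, alpha_2, alpha_3 give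
    back floor(4 l / 5) - floor(j l / 5) at the primes with j = 1, 2, 3.

    The units [u_] and the integer m settle the prime 5. They make beta = 1 modulo 1 - zeta and the
    trace of alpha equal to minus the Legendre symbol, hence a unit. This matters because 1 + zeta +
    ... + zeta^4 = 0: an element of Z[zeta] determines five coordinates only up to a common
    constant. The trace fixes that constant up to a denominator 5, which is excluded because the
    denominator coming from the dual element is prime to 5. *)

Lemma prim5_exp4 (F : fieldType) (z : F) : 5.-primitive_root z ->
  z ^+ 4 = - 1 - z - z ^+ 2 - z ^+ 3.
Proof.
move=> zP; have z5 := prim_expr_order zP.
have z1 : z - 1 != 0.
  by rewrite subr_eq0 -[z]expr1 -(prim_order_dvd zP).
apply/eqP; rewrite -subr_eq0; apply/eqP; apply: (mulfI z1).
by ring: z5.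
Qed.

(** Inverse Fourier transform over the fifth roots of unity. The weight w^(-jk) extracts [u_k] and
    w^j = w^(-4j) extracts [u4]; in their difference the term of the trivial root cancels, so the
    values at the four primitive roots suffice. The ring is arbitrary because both [algC] and ['F_p]
    occur. *)
Lemma fourier_zeta (F : comNzRingType) (w u0 u1 u2 u3 u4 : F) (k : nat) :
    w ^+ 4 = - 1 - w - w ^+ 2 - w ^+ 3 ->
  let P x := u0 + u1 * x + u2 * x ^+ 2 + u3 * x ^+ 3 + u4 * x ^+ 4 in
  (k < 4)%N ->
  \sum_(j < 4) P (w ^+ j.+1) * (w ^+ (j.+1 * (5 - k)) - w ^+ j.+1) =
    5 * ([:: u0; u1; u2; u3]`_k - u4).
Proof.
move=> w4 P k4; rewrite /P !big_ord_recl big_ord0 /=.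
by move: k k4 => [|[|[|[|]]]] //= _; rewrite /bump /= -!exprM /=; ring: w4.
Qed.

Definition zlin (z u0 u1 u2 u3 : algC) : algC :=
  u0 + u1 * z + u2 * z ^+ 2 + u3 * z ^+ 3.

Lemma zlin_aut (f : {rmorphism algC -> algC}) z u0 u1 u2 u3 :
  f (zlin z u0 u1 u2 u3) = zlin (f z) (f u0) (f u1) (f u2) (f u3).
Proof. by rewrite /zlin !rmorphD !rmorphM. Qed.

Section CyclotomicIntegers.

Variable zeta : algC.
Hypothesis zeta_prim : 5.-primitive_root zeta.

Let z5 : zeta ^+ 5 = 1 := prim_expr_order zeta_prim.
Let z4 := prim5_exp4 zeta_prim.

Notation Z := (Zzeta zeta).
Notation dvd := (Zzeta_dvd zeta).

Lemma ZzetaP (x : algC) : Z x ->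
  exists u0 u1 u2 u3 : int, x = zlin zeta u0%:~R u1%:~R u2%:~R u3%:~R.
Proof.
case=> p ->; elim/poly_ind: p => [|p c [u0 [u1 [u2 [u3 IH]]]]].
  by exists 0, 0, 0, 0; rewrite rmorph0 horner0 /zlin; ring.
exists (c - u3), (u0 - u3), (u1 - u3), (u2 - u3).
rewrite rmorphD rmorphM /= map_polyX map_polyC hornerMXaddC IH /zlin /=.
by rewrite !rmorphB /=; ring: z4.
Qed.

Lemma Zzeta_int (u : int) : Z u%:~R.
Proof. by exists u%:P; rewrite map_polyC hornerC. Qed.

Lemma Zzeta_nat (u : nat) : Z u%:R.
Proof. exact: (Zzeta_int u). Qed.

Lemma Zzeta0 : Z 0. Proof. exact: (Zzeta_int 0). Qed.
Lemma Zzeta1 : Z 1. Proof. exact: (Zzeta_int 1). Qed.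

Lemma Zzeta_zeta : Z zeta.
Proof. by exists 'X; rewrite map_polyX hornerX. Qed.

Lemma ZzetaD x y : Z x -> Z y -> Z (x + y).
Proof. by case=> p -> [q ->]; exists (p + q); rewrite rmorphD hornerD. Qed.

Lemma ZzetaN x : Z x -> Z (- x).
Proof. by case=> p ->; exists (- p); rewrite rmorphN hornerN. Qed.

Lemma ZzetaB x y : Z x -> Z y -> Z (x - y).
Proof. by move=> Zx Zy; apply: ZzetaD => //; apply: ZzetaN. Qed.

Lemma ZzetaM x y : Z x -> Z y -> Z (x * y).
Proof. by case=> p -> [q ->]; exists (p * q); rewrite rmorphM hornerM. Qed.

Lemma ZzetaX x k : Z x -> Z (x ^+ k).
Proof.
by move=> Zx; elim: k => [|k IH]; [apply: Zzeta1 | rewrite exprS; apply: ZzetaM].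
Qed.

Lemma Zzeta_zlin (u0 u1 u2 u3 : int) : Z (zlin zeta u0%:~R u1%:~R u2%:~R u3%:~R).
Proof.
by do 3?[apply: ZzetaD]; rewrite ?[_%:~R * _]mulrC; do ?[apply: ZzetaM];
   do ?[apply: ZzetaX]; do ?[apply: Zzeta_int | apply: Zzeta_zeta].
Qed.

Lemma Zzeta_prod (I : finType) (F : I -> algC) :
  (forall i, Z (F i)) -> Z (\prod_i F i).
Proof.
by move=> ZF; elim/big_ind: _ => //; [apply: Zzeta1 | apply: ZzetaM].
Qed.

Lemma Zzeta_Aint x : Z x -> x \in Aint.
Proof.
case=> p ->; elim/poly_ind: p => [|p c IH].
  by rewrite rmorph0 horner0 rpred0.
rewrite rmorphD rmorphM /= map_polyX map_polyC hornerMXaddC /=.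
by rewrite rpredD ?rpredM ?Aint_int ?(Aint_prim_root zeta_prim).
Qed.

Lemma Zdvd_int (d x : int) : dvd d%:~R x%:~R -> (d %| x)%Z.
Proof.
case=> q Zq E.
have [d0|dn0] := eqVneq d 0.
  by move: E; rewrite d0 mul0r => /eqP; rewrite intr_eq0 => /eqP->.
have dC : d%:~R != 0 :> algC by rewrite intr_eq0.
have : q \in Num.int.
  apply: Cint_rat_Aint (Zzeta_Aint Zq).
  have -> : q = x%:~R / d%:~R by rewrite E mulrC mulKf.
  by rewrite rpred_div // ?rpred_int.
case/intrP=> m Em; apply/dvdzP; exists m.
by apply: (@intr_inj algC); rewrite E Em rmorphM mulrC.
Qed.

Lemma Zdvd_refl x : dvd x x.
Proof. by exists 1; [apply: Zzeta1 | rewrite mulr1]. Qed.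

Lemma Zdvd0 x : dvd x 0.
Proof. by exists 0; [apply: Zzeta0 | rewrite mulr0]. Qed.

Lemma Zdvd_trans y x w : dvd x y -> dvd y w -> dvd x w.
Proof.
by case=> q Zq -> [s Zs ->]; exists (q * s); [apply: ZzetaM | rewrite mulrA].
Qed.

Lemma Zdvd_add x y w : dvd x y -> dvd x w -> dvd x (y + w).
Proof.
by case=> q Zq -> [s Zs ->]; exists (q + s); [apply: ZzetaD | rewrite mulrDr].
Qed.

Lemma Zdvd_opp x y : dvd x y -> dvd x (- y).
Proof. by case=> q Zq ->; exists (- q); [apply: ZzetaN | rewrite mulrN]. Qed.

Lemma Zdvd_sub x y w : dvd x y -> dvd x w -> dvd x (y - w).
Proof. by move=> xy xw; apply: Zdvd_add => //; apply: Zdvd_opp. Qed.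

Lemma Zdvd_mulr x y w : Z w -> dvd x y -> dvd x (y * w).
Proof.
by move=> Zw [q Zq ->]; exists (q * w); [apply: ZzetaM | rewrite mulrA].
Qed.

Lemma Zdvd_mull x y w : Z w -> dvd x y -> dvd x (w * y).
Proof. by rewrite mulrC; apply: Zdvd_mulr. Qed.

Lemma Zdvd_mul x y x' y' : dvd x y -> dvd x' y' -> dvd (x * x') (y * y').
Proof.
by case=> q Zq -> [s Zs ->]; exists (q * s); [apply: ZzetaM | rewrite mulrACA].
Qed.

Lemma Zdvd_nat (d x : nat) : dvd d%:R x%:R -> (d %| x)%N.
Proof. by move/(@Zdvd_int d x). Qed.

Lemma int_Zdvd (d x : int) : (d %| x)%Z -> dvd d%:~R x%:~R.
Proof.
by case/dvdzP=> q ->; exists q%:~R; [apply: Zzeta_int | rewrite rmorphM mulrC].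
Qed.

Lemma zeta_prim_exp k : (0 < k < 5)%N -> 5.-primitive_root (zeta ^+ k).
Proof.
move=> k5; rewrite prim_root_exp_coprime //.
by move: k k5 => [|[|[|[|[|]]]]].
Qed.

Lemma zeta_aut k : (0 < k < 5)%N ->
  {nu : {rmorphism algC -> algC} | nu zeta = zeta ^+ k}.
Proof.
move=> k5; have [|nu nuE] := @Qn_aut_exists k 5.
  by move: k k5 => [|[|[|[|[|]]]]].
by exists nu; rewrite nuE.
Qed.

Lemma Zzeta_aut (nu : {rmorphism algC -> algC}) k x :
  nu zeta = zeta ^+ k -> Z x -> Z (nu x).
Proof.
move=> nuE /ZzetaP[u0 [u1 [u2 [u3 ->]]]]; rewrite zlin_aut !rmorph_int nuE.
by do 3?[apply: ZzetaD]; do ?[apply: ZzetaM];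
   do ?[apply: ZzetaX]; do ?[apply: Zzeta_int | apply: Zzeta_zeta].
Qed.

(** Automorphisms of [algC] fix the rational coefficients and carry [x] to the values of its
    polynomial at all four primitive roots, to which [fourier_zeta] applies. Thus the rational
    relations between the powers of zeta are the multiples of 1 + zeta + ... + zeta^4, and algebraic
    integers have denominator at most 5. *)
Lemma fourier_rat (u0 u1 u2 u3 u4 : algC) (k : nat) :
    u0 \in Crat -> u1 \in Crat -> u2 \in Crat -> u3 \in Crat -> u4 \in Crat ->
    (k < 4)%N ->
  let x := zlin zeta u0 u1 u2 u3 + u4 * zeta ^+ 4 in
  (x = 0 -> [:: u0; u1; u2; u3]`_k = u4) /\
  (x \in Aint -> 5 * ([:: u0; u1; u2; u3]`_k - u4) \in Num.int).
Proof.
move=> Q0 Q1 Q2 Q3 Q4 k4 x.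
pose P t := u0 + u1 * t + u2 * t ^+ 2 + u3 * t ^+ 3 + u4 * t ^+ 4.
have [nu nuE] : exists nu : 'I_4 -> {rmorphism algC -> algC},
    forall j, nu j zeta = zeta ^+ j.+1.
  have ex (j : 'I_4) : {nu : {rmorphism algC -> algC} | nu zeta = zeta ^+ j.+1}.
    by apply: zeta_aut; rewrite /= ltnS.
  by exists (fun j => sval (ex j)) => j; case: (ex j).
have PE (j : 'I_4) : P (zeta ^+ j.+1) = nu j x.
  rewrite /P /x /zlin !rmorphD !rmorphM /= !nuE.
  by rewrite !(aut_Crat (nu j)) //; ring.
have E : \sum_(j < 4) P (zeta ^+ j.+1)
      * (zeta ^+ (j.+1 * (5 - k)) - zeta ^+ j.+1) =
    5 * ([:: u0; u1; u2; u3]`_k - u4) by apply: fourier_zeta.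
split=> [x0|Ax].
  apply/eqP; rewrite -subr_eq0.
  have /eqP : 5 * ([:: u0; u1; u2; u3]`_k - u4) = 0.
    by rewrite -E big1 // => j _; rewrite PE x0 rmorph0 mul0r.
  by rewrite mulf_eq0 pnatr_eq0.
apply: Cint_rat_Aint.
  rewrite rpredM ?rpred_nat ?rpredB //.
  by move: k k4 {E} => [|[|[|[|]]]].
rewrite -E rpred_sum // => j _.
have Az : zeta \in Aint by apply: Aint_prim_root zeta_prim.
by rewrite PE rpredM ?Aint_aut ?rpredB ?rpredX.
Qed.

(** Five coordinates are kept, as they will be coefficients on a normal basis; membership in Z[zeta]
    sees only their differences. *)
Lemma coord_Zzeta (u0 u1 u2 u3 u4 : algC) (k : nat) :
    u0 \in Crat -> u1 \in Crat -> u2 \in Crat -> u3 \in Crat -> u4 \in Crat ->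
    (k < 4)%N ->
    Z (zlin zeta u0 u1 u2 u3 + u4 * zeta ^+ 4) ->
  [:: u0; u1; u2; u3]`_k - u4 \in Num.int.
Proof.
move=> Q0 Q1 Q2 Q3 Q4 k4 /ZzetaP[v0 [v1 [v2 [v3 E]]]].
have QB u (v : int) : u \in Crat -> u - v%:~R \in Crat.
  by move=> Qu; rewrite rpredB ?rpred_int.
have [+ _] := fourier_rat (QB _ v0 Q0) (QB _ v1 Q1) (QB _ v2 Q2) (QB _ v3 Q3)
  Q4 k4.
have E0 : zlin zeta (u0 - v0%:~R) (u1 - v1%:~R) (u2 - v2%:~R) (u3 - v3%:~R)
            + u4 * zeta ^+ 4 = 0.
  by apply/eqP; rewrite -(subrr (zlin zeta u0 u1 u2 u3 + u4 * zeta ^+ 4)) {2}E /zlin;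
     apply/eqP; ring.
move=> /(_ E0); move: k k4 => [|[|[|[|]]]] //= _ <-;
  by rewrite opprB addrC subrK rpred_int.
Qed.

(** The lost factor 5 is harmless later, where only primes dividing Delta_n, all different from 5,
    are inverted. *)
Lemma Aint_Zzeta5 (u0 u1 u2 u3 : algC) :
    u0 \in Crat -> u1 \in Crat -> u2 \in Crat -> u3 \in Crat ->
    zlin zeta u0 u1 u2 u3 \in Aint ->
  Z (5 * zlin zeta u0 u1 u2 u3).
Proof.
move=> Q0 Q1 Q2 Q3 Ax.
have h k : (k < 4)%N -> 5 * [:: u0; u1; u2; u3]`_k \in Num.int.
  move=> k4; have [_ +] := fourier_rat Q0 Q1 Q2 Q3 (rpred0 _) k4.
  by rewrite mul0r addr0 subr0 => /(_ Ax).
have /intrP[v0 E0] := h 0%N isT; have /intrP[v1 E1] := h 1%N isT.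
have /intrP[v2 E2] := h 2%N isT; have /intrP[v3 E3] := h 3%N isT.
rewrite /= in E0 E1 E2 E3.
have -> : 5 * zlin zeta u0 u1 u2 u3 = zlin zeta v0%:~R v1%:~R v2%:~R v3%:~R.
  by rewrite /zlin -E0 -E1 -E2 -E3; ring.
exact: Zzeta_zlin.
Qed.

End CyclotomicIntegers.

(** * Z[zeta] is Euclidean *)

(* The open arcs between consecutive multiples of 1/5 outnumber the four
   fractional parts: cut the circle R/Z at an arc which contains none of them. *)
Lemma rounding4 (u : 'I_4 -> rat) : exists (k : nat) (s : 'I_4 -> int),
  (k < 5)%N /\ forall i, (k%:R - 4) / 5 <= u i - (s i)%:~R < k%:R / 5.
Proof.
pose f i := u i - (Num.floor (u i))%:~R.
have f0 i : 0 <= f i by rewrite /f subr_ge0 ge_floor.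
have f1 i : f i < 1 by rewrite /f ltrBlDl; have := lt_succ_floor (u i); rewrite intrD.
pose t i := `|Num.floor (5 * f i)|%N.
have [k k5 kt] : exists2 k, (k < 5)%N & forall i, k != t i.
  have /allPn[k] : ~~ all (mem (codom t)) (iota 0 5).
    apply/negP => /allP sub.
    have := uniq_leq_size (iota_uniq 0 5) sub.
    by rewrite size_codom card_ord size_iota.
  rewrite mem_iota => k5 kt; exists k => // i.
  by apply: contraNneq kt => ->; apply: codom_f.
have ft i : f i < k%:R / 5 \/ (k%:R + 1) / 5 <= f i.
  have ge0 : 0 <= 5 * f i by rewrite mulr_ge0.
  have tE : (t i)%:R = (Num.floor (5 * f i))%:~R :> rat.
    by rewrite /t -[RHS]ger0_norm ?ler0z ?floor_ge0 // -intr_norm -abszE.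
  have tl := ge_floor (5 * f i); have tu := lt_succ_floor (5 * f i).
  rewrite intrD -tE in tu; rewrite -tE in tl.
  have := kt i; rewrite neq_ltn => /orP[lt|lt]; [right|left].
    have : k.+1%:R <= (t i)%:R :> rat by rewrite ler_nat.
    by rewrite -natr1; lra.
  have : (t i).+1%:R <= k%:R :> rat by rewrite ler_nat.
  by rewrite -natr1; lra.
exists k, (fun i => Num.floor (u i) + Posz ((k%:R + 1) / 5 <= f i)%R).
split=> // i.
have uE b : u i - (Num.floor (u i) + b)%:~R = f i - b%:~R.
  by rewrite /f [in LHS]intrD opprD addrA.
rewrite {}uE; move: (f i) (f0 i) (f1 i) (ft i) => x x0 x1 hx.
have k4 : k%:R <= 4 :> rat by rewrite (ler_nat _ k 4) -ltnS.
have k0 : 0 <= k%:R :> rat by rewrite ler0n.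
case: hx => hx; case: (leP ((k%:R + 1) / 5) x) => hx' /=;
  by rewrite ?mulr0z ?mulr1z ?subr0; lra.
Qed.

(** The left side is the sum of (w_i - w_j)^2 over all pairs, hence invariant under a common shift;
    this is what allows centring the window of [rounding4] at 0. The squares alone give at most 5 *
    5 * 4/25 = 4, and equality would force w0, ..., w3 to be -2/5, so that the subtracted square is
    positive. *)
Lemma spread_lt4 (w0 w1 w2 w3 w4 : rat) :
    -2/5 <= w0 < 2/5 -> -2/5 <= w1 < 2/5 -> -2/5 <= w2 < 2/5 ->
    -2/5 <= w3 < 2/5 -> -2/5 <= w4 <= 2/5 ->
  5 * (w0 ^+ 2 + w1 ^+ 2 + w2 ^+ 2 + w3 ^+ 2 + w4 ^+ 2)
    - (w0 + w1 + w2 + w3 + w4) ^+ 2 < 4.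
Proof.
move=> h0 h1 h2 h3 h4; rewrite ltNge; apply/negP => H.
have sq (w : rat) : -2/5 <= w <= 2/5 -> w ^+ 2 <= 4/25 by move=> h; nra.
have q0 : w0 ^+ 2 <= 4/25 by apply: sq; lra.
have q1 : w1 ^+ 2 <= 4/25 by apply: sq; lra.
have q2 : w2 ^+ 2 <= 4/25 by apply: sq; lra.
have q3 : w3 ^+ 2 <= 4/25 by apply: sq; lra.
have q4 : w4 ^+ 2 <= 4/25 by apply: sq.
have S := sqr_ge0 (w0 + w1 + w2 + w3 + w4).
have eqm (w : rat) : -2/5 <= w < 2/5 -> 4/25 <= w ^+ 2 -> w = -2/5.
  move=> h hh; apply/eqP; rewrite eq_le; apply/andP; split; last lra.
  by nra.
have e0 : w0 = -2/5 by apply: eqm; lra.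
have e1 : w1 = -2/5 by apply: eqm; lra.
have e2 : w2 = -2/5 by apply: eqm; lra.
have e3 : w3 = -2/5 by apply: eqm; lra.
by subst; nra.
Qed.

Section Euclid.

Variable zeta : algC.
Hypothesis zeta_prim : 5.-primitive_root zeta.

Let z5 : zeta ^+ 5 = 1 := prim_expr_order zeta_prim.
Let z4 := prim5_exp4 zeta_prim.

Notation Z := (Zzeta zeta).
Notation dvd := (Zzeta_dvd zeta).

Definition zrat (u0 u1 u2 u3 : rat) : algC :=
  zlin zeta (ratr u0) (ratr u1) (ratr u2) (ratr u3).

(** With eta = zeta + zeta^4, a root of X^2 + X - 1, the absolute square of [zrat u0 u1 u2 u3] is
    [nm_s + nm_t * eta], and [nm] is the norm of this element from Q(sqrt 5) to Q. *)
Definition nm_s (u0 u1 u2 u3 : rat) : rat :=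
  u0 ^+ 2 + u1 ^+ 2 + u2 ^+ 2 + u3 ^+ 2 - (u0 * u2 + u1 * u3 + u0 * u3).
Definition nm_t (u0 u1 u2 u3 : rat) : rat :=
  u0 * u1 + u1 * u2 + u2 * u3 - (u0 * u2 + u1 * u3 + u0 * u3).
Definition nm u0 u1 u2 u3 : rat :=
  let s := nm_s u0 u1 u2 u3 in let t := nm_t u0 u1 u2 u3 in
  s ^+ 2 - s * t - t ^+ 2.

Lemma zeta_conj : zeta^* = zeta ^+ 4.
Proof.
have n1 : `|zeta| = 1 by apply/eqP; rewrite -(pexpr_eq1 (n := 5)) // -normrX z5 normr1.
have zn0 : zeta != 0 by rewrite -normr_eq0 n1 oner_eq0.
by apply: (mulfI zn0); rewrite -normCK n1 expr1n -exprS z5.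
Qed.

(** The norm of Q(zeta) over Q: the four conjugates form two complex conjugate pairs, represented by
    the identity and an automorphism sending zeta to zeta^2. On all of [algC] it remains
    multiplicative and nonnegative. *)
Definition znorm (x : algC) : algC :=
  `|x| ^+ 2 * `|sval (zeta_aut zeta_prim (isT : (0 < 2 < 5)%N)) x| ^+ 2.

Lemma znormM x y : znorm (x * y) = znorm x * znorm y.
Proof. by rewrite /znorm rmorphM !normrM /=; ring. Qed.

Lemma znorm_ge0 x : 0 <= znorm x.
Proof. by rewrite mulr_ge0 ?exprn_ge0. Qed.

Lemma znorm_eq0 x : (znorm x == 0) = (x == 0).
Proof. by rewrite mulf_eq0 !sqrf_eq0 !normr_eq0 fmorph_eq0 orbb. Qed.

Lemma znorm_nm u0 u1 u2 u3 : znorm (zrat u0 u1 u2 u3) = ratr (nm u0 u1 u2 u3).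
Proof.
rewrite /znorm; case: zeta_aut => nu /= nuE.
rewrite !normCK /zrat !zlin_aut !fmorph_rat !nuE.
rewrite (rmorphXn Num.conj) /= zeta_conj /zlin /nm /nm_s /nm_t.
rewrite !(rmorphD, rmorphB, rmorphN, rmorphM, rmorphXn) /=.
by ring: z4.
Qed.

Lemma zrat_int (v0 v1 v2 v3 : int) :
  zrat v0%:~R v1%:~R v2%:~R v3%:~R = zlin zeta v0%:~R v1%:~R v2%:~R v3%:~R.
Proof. by rewrite /zrat !ratr_int. Qed.

Lemma znorm_nat y : Z y -> znorm y \in Num.nat.
Proof.
move=> /(ZzetaP zeta_prim)[v0 [v1 [v2 [v3 ->]]]]; rewrite natrEint znorm_ge0 andbT.
rewrite -zrat_int znorm_nm /nm /nm_s /nm_t.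
rewrite -!(rmorphM, rmorphXn, rmorphD, rmorphB) /= ratr_int.
exact: intr_int.
Qed.

Lemma Zzeta_codivisor y : Z y -> exists2 y', Z y' & y * y' = znorm y.
Proof.
move=> Zy; have [nu [k nuE] normE] : exists2 nu : {rmorphism algC -> algC},
    exists k, nu zeta = zeta ^+ k & znorm y = `|y| ^+ 2 * `|nu y| ^+ 2.
  by rewrite /znorm; case: zeta_aut => nu /= nuE; exists nu => //; exists 2%N.
have Zc x : Z x -> Z x^* by apply: (Zzeta_aut zeta_prim (k := 4)) zeta_conj.
exists (y^* * (nu y * (nu y)^*)).
  have Zn : Z (nu y) by apply: (Zzeta_aut zeta_prim nuE).
  by do !apply: ZzetaM => //; apply: Zc.
by rewrite normE !normCK mulrA.
Qed.

Lemma Zzeta_euclid x y : Z x -> Z y -> y != 0 ->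
  exists2 q, Z q & znorm (x - q * y) < znorm y.
Proof.
move=> Zx Zy y0; have [y' Zy' yy'] := Zzeta_codivisor Zy.
have /natrP[N NE] := znorm_nat Zy.
have N0 : N != 0%N by rewrite -(eqr_nat algC) -NE znorm_eq0.
have NC : N%:R != 0 :> algC by rewrite pnatr_eq0.
have [v0 [v1 [v2 [v3 xy']]]] := ZzetaP zeta_prim (ZzetaM Zx Zy').
pose u (i : 'I_4) : rat := [:: v0%:~R; v1%:~R; v2%:~R; v3%:~R]`_i / N%:R.
have [k [s [k5 us]]] := rounding4 u.
pose s_ (j : nat) : int := s (inord j).
pose w (j : nat) : rat := [:: v0%:~R; v1%:~R; v2%:~R; v3%:~R]`_j / N%:R - (s_ j)%:~R.
have wb j : (j < 4)%N -> (k%:R - 4) / 5 <= w j < k%:R / 5.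
  by move=> j4; have := us (inord j); rewrite /u inordK.
pose q := zlin zeta (s_ 0%N)%:~R (s_ 1%N)%:~R (s_ 2%N)%:~R (s_ 3%N)%:~R.
have Zq : Z q by apply: Zzeta_zlin.
exists q => //.
have -> : x - q * y = zrat (w 0%N) (w 1%N) (w 2%N) (w 3%N) * y.
  have -> : x - q * y = (x * y' / N%:R - q) * y.
    rewrite mulrBl; congr (_ - _); apply: (mulIf NC); rewrite -[in LHS]NE -yy'.
    by rewrite mulrAC divfK //; ring.
  congr (_ * _); rewrite xy' /zrat /w /q /zlin /=.
  by rewrite !rmorphB !fmorph_div /= !ratr_int !ratr_nat; field.
rewrite znormM gtr_pMl; last by rewrite lt_def znorm_eq0 y0 znorm_ge0.
rewrite znorm_nm -(rmorph1 (ratr : {rmorphism rat -> algC})) ltr_rat.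
(* The window [(k-4)/5, k/5) has centre (k-2)/5. Subtracting the centre from all five coordinates
   also moves the fifth one, which was 0, to -(k-2)/5; this is [c4]. *)
have c0 : -2/5 <= w 0%N - (k%:R - 2) / 5 < 2/5 by have := wb 0%N isT; lra.
have c1 : -2/5 <= w 1%N - (k%:R - 2) / 5 < 2/5 by have := wb 1%N isT; lra.
have c2 : -2/5 <= w 2%N - (k%:R - 2) / 5 < 2/5 by have := wb 2%N isT; lra.
have c3 : -2/5 <= w 3%N - (k%:R - 2) / 5 < 2/5 by have := wb 3%N isT; lra.
have k4 : k%:R <= 4 :> rat by rewrite (ler_nat _ k 4) -ltnS.
have k0 : 0 <= k%:R :> rat by rewrite ler0n.
have c4 : -2/5 <= - (((k%:R : rat) - 2) / 5) <= 2/5 by lra.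
have := spread_lt4 c0 c1 c2 c3 c4.
move: (w 0%N) (w 1%N) (w 2%N) (w 3%N) => a b c d sp.
(* [e] is the sum of the two absolute squares whose product is the norm, and 2e is the quantity
   bounded by [spread_lt4]. So e < 2, and the inequality of arithmetic and geometric means gives
   norm at most e^2 / 4 < 1. *)
set e := 2 * nm_s a b c d - nm_t a b c d.
have e2 : e < 2 by rewrite /e /nm_s /nm_t; move: sp; lra.
have e0 : 0 <= e.
  have := (sqr_ge0 (a - b), sqr_ge0 (a - c), sqr_ge0 (a - d),
           sqr_ge0 (b - c), sqr_ge0 (b - d)).
  have := (sqr_ge0 (c - d), sqr_ge0 a, sqr_ge0 b, sqr_ge0 c, sqr_ge0 d).
  rewrite /e /nm_s /nm_t => -[[[[h1 h2] h3] h4] h5] [[[[h6 h7] h8] h9] h10].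
  by lra.
have -> : nm a b c d = (e ^+ 2 - 5 * nm_t a b c d ^+ 2) / 4.
  by rewrite /nm /e; field.
by have := sqr_ge0 (nm_t a b c d); nra.
Qed.

Lemma Zzeta_bezout x y : Z x -> Z y -> exists d u v,
  [/\ Z u, Z v, d = u * x + v * y, dvd d x & dvd d y].
Proof.
move=> Zx Zy; have /natrP[N] := znorm_nat Zy.
elim/ltn_ind: N => N IH in x y Zx Zy * => NE.
have [y0|y0] := eqVneq y 0.
  exists x, 1, 0; split; [exact: Zzeta1|exact: Zzeta0|by rewrite y0; ring| |].
    exact: Zdvd_refl.
  by rewrite y0; apply: Zdvd0.
have [q Zq lt] := Zzeta_euclid Zx Zy y0.
have Zr : Z (x - q * y) by apply: ZzetaB => //; apply: ZzetaM.
have /natrP[N' NE'] := znorm_nat Zr.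
have ltN : (N' < N)%N by rewrite -(ltr_nat algC) -NE -NE'.
have [d [u [v [Zu Zv dE dy dr]]]] := IH _ ltN _ _ Zy Zr NE'.
exists d, v, (u - v * q); split=> //.
- by apply: ZzetaB => //; apply: ZzetaM.
- by rewrite dE; ring.
by rewrite -(subrK (q * y) x); apply: Zdvd_add => //; apply: Zdvd_mull.
Qed.

End Euclid.

(** * Valuations at prime elements *)

Section Valuation.

Variable zeta : algC.

Notation Z := (Zzeta zeta).
Notation dvd := (Zzeta_dvd zeta).

(** An exact power as a relation: values are computed from known factorisations by multiplicativity,
    without a valuation function on all of Z[zeta]. *)
Definition zval pi x e := exists2 y, Z y /\ ~ dvd pi y & x = pi ^+ e * y.

Lemma zval0 pi x : Z x -> ~ dvd pi x -> zval pi x 0.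
Proof. by move=> Zx nx; exists x => //; rewrite mul1r. Qed.

Variable pi : algC.
Hypothesis pi_prime : Zzeta_prime zeta pi.

Let Zpi : Z pi. Proof. by case: pi_prime. Qed.
Let pi0 : pi != 0. Proof. by case: pi_prime => _ /eqP. Qed.

Lemma prime_ndvd1 : ~ dvd pi 1.
Proof. by case: pi_prime => _ _ nu _ h; apply: nu; split. Qed.

Lemma prime_dvdM x y : Z x -> Z y -> dvd pi (x * y) -> dvd pi x \/ dvd pi y.
Proof. by case: pi_prime => _ _ _; apply. Qed.

Lemma prime_dvdX x e : Z x -> dvd pi (x ^+ e) -> dvd pi x.
Proof.
move=> Zx; elim: e => [/prime_ndvd1|e IH] //.
by rewrite exprS => /prime_dvdM-[] //; apply: ZzetaX.
Qed.

Lemma zvalM x y e f : zval pi x e -> zval pi y f -> zval pi (x * y) (e + f).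
Proof.
case=> x' [Zx nx] -> [y' [Zy ny] ->]; exists (x' * y').
  by split; [apply: ZzetaM | move=> /prime_dvdM[]].
by rewrite exprD mulrACA.
Qed.

Lemma zval1 : zval pi 1 0.
Proof. by apply: zval0 prime_ndvd1; apply: Zzeta1. Qed.

Lemma zvalX x e m : zval pi x e -> zval pi (x ^+ m) (m * e).
Proof.
by move=> vx; elim: m => [|m IH]; [apply: zval1 | rewrite exprS mulSn; apply: zvalM].
Qed.

Lemma zval_prod (I : finType) (F : I -> algC) (e : I -> nat) :
  (forall i, zval pi (F i) (e i)) -> zval pi (\prod_i F i) (\sum_i e i).
Proof.
by move=> vF; elim/big_ind2: _ => //; [apply: zval1 | move=> *; apply: zvalM].
Qed.

Lemma zval_unit x : Z x -> dvd x 1 -> zval pi x 0.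
Proof.
by move=> Zx x1; apply: zval0 => // pix; apply: prime_ndvd1; apply: Zdvd_trans x1.
Qed.

Lemma zval_dvd x e f : zval pi x e -> dvd (pi ^+ f) x -> (f <= e)%N.
Proof.
case=> y [Zy ny] -> [q Zq E]; rewrite leqNgt; apply/negP => lt_ef.
apply: ny; exists (pi ^+ (f - e).-1 * q).
  by apply: ZzetaM => //; apply: ZzetaX.
have pe0 : pi ^+ e != 0 by rewrite expf_neq0.
apply: (mulfI pe0); rewrite E !mulrA -exprSr -exprD; congr (pi ^+ _ * q).
by rewrite -[in LHS](subnKC lt_ef); lia.
Qed.

Lemma dvd_zval x e f : zval pi x e -> (f <= e)%N -> dvd (pi ^+ f) x.
Proof.
case=> y [Zy ny] -> le; exists (pi ^+ (e - f) * y).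
  by apply: ZzetaM => //; apply: ZzetaX.
by rewrite mulrA -exprD subnKC.
Qed.

Lemma zval_cancel x y e : Z x -> Z y -> ~ dvd pi y -> zval pi (x * y) e ->
  zval pi x e.
Proof.
move=> + Zy ny; elim: e x => [|e IH] x Zx [t [Zt nt] E].
  apply: zval0 => // pix; apply: nt; move: E; rewrite mul1r => <-.
  exact: Zdvd_mulr.
have pxy : dvd pi (x * y).
  rewrite E exprS -mulrA; exists (pi ^+ e * t) => //.
  by apply: ZzetaM => //; apply: ZzetaX.
case: (prime_dvdM Zx Zy pxy) => [[x' Zx' x'E]|//].
have [|s [Zs ns] sE] := IH x' Zx'.
  exists t => //; apply: (mulfI pi0); rewrite mulrA -x'E E.
  by rewrite exprS mulrA.
by exists s => //; rewrite x'E sE exprS mulrA.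
Qed.

Lemma Zdvd_cancel x y e : Z x -> Z y -> ~ dvd pi y -> dvd (pi ^+ e) (x * y) ->
  dvd (pi ^+ e) x.
Proof.
move=> + Zy ny; elim: e x => [|e IH] x Zx [t Zt E].
  by exists x; rewrite ?mul1r.
have pxy : dvd pi (x * y).
  rewrite E exprS -mulrA; exists (pi ^+ e * t) => //.
  by apply: ZzetaM => //; apply: ZzetaX.
case: (prime_dvdM Zx Zy pxy) => [[x' Zx' x'E]|//].
have [|s Zs sE] := IH x' Zx'.
  exists t => //; apply: (mulfI pi0); rewrite mulrA -x'E E.
  by rewrite exprS mulrA.
by exists s => //; rewrite x'E sE exprS mulrA.
Qed.

End Valuation.

(** * Primes above the divisors of Delta *)

Lemma bezout_int (p q : int) : coprimez p q -> exists u v, u * p + v * q = 1.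
Proof. by case: (Bezoutz p q) => u [v uv] /eqP pq; exists u, v; rewrite uv pq. Qed.

(** Modulo 5 only n^4 survives, and it is 1 by Fermat. *)
Lemma Delta_mod5 (n : int) : ~~ (5 %| n)%Z -> (lehmer_Delta n == 1 %[mod 5])%Z.
Proof.
move=> n5; rewrite /lehmer_Delta.
have [q [r [nE r5]]] : exists q r : int,
    n = q * 5 + r /\ (r = 1 \/ r = 2 \/ r = 3 \/ r = 4).
  exists (n %/ 5)%Z, (n %% 5)%Z; split; first exact: divz_eq.
  have := modz_ge0 n (isT : 5%:Z != 0); have := ltz_pmod n (isT : 0 < 5%:Z).
  have : (n %% 5)%Z != 0 by apply: contraNneq n5 => /dvdz_mod0P.
  by lia.
rewrite eqz_mod_dvd; apply/dvdzP.
(* The Taylor expansion of (Delta(5q + r) - 1) / 5 in q; 14, 38, 90, 188 are its constant terms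
   (Delta(r) - 1) / 5 for r = 1, 2, 3, 4. *)
exists (125 * q ^+ 4 + (100 * r + 125) * q ^+ 3
  + (30 * r ^+ 2 + 75 * r + 75) * q ^+ 2
  + (4 * r ^+ 3 + 15 * r ^+ 2 + 30 * r + 25) * q
  + (if r == 1 then 14 else if r == 2 then 38 else if r == 3 then 90 else 188)).
by rewrite nE; case: r5 => [->|[->|[->|->]]] /=; ring.
Qed.

Lemma A_aut (nu : {rmorphism algC -> algC}) w n : nu (A_ w n) = A_ (nu w) n.
Proof. by rewrite /A_; ring. Qed.

Section SplitPrimes.

Variables (zeta : algC) (n : int).
Hypothesis zeta_prim : 5.-primitive_root zeta.
Hypothesis n_not5 : ~~ (5 %| n)%Z.

Let z5 : zeta ^+ 5 = 1 := prim_expr_order zeta_prim.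

Notation Z := (Zzeta zeta).
Notation dvd := (Zzeta_dvd zeta).
Notation Ak k := (A_ (zeta ^+ k) n).

Definition lehmer_h : int := n ^+ 3 + 4 * n ^+ 2 + 10 * n + 10.

Lemma Zzeta_zetaX k : Z (zeta ^+ k).
Proof. by apply: ZzetaX; apply: Zzeta_zeta. Qed.

Lemma ZAk k : Z (Ak k).
Proof.
rewrite /A_; do 3?[apply: ZzetaD]; try exact: Zzeta_int.
- exact: Zzeta_nat.
- by apply: ZzetaM; [apply: Zzeta_nat | rewrite -exprM; apply: Zzeta_zetaX].
by rewrite -exprM; apply: Zzeta_zetaX.
Qed.

(** Write h(N) for [lehmer_h] and w for zeta^k. Then N - A = -2 - 2 w^4 - w^2 and h(N - A) = 5 w;
    the witness is the difference quotient (h(N) - h(N - A)) / A. *)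
Lemma Ak_dvd_h k : (0 < k < 5)%N -> dvd (Ak k) (lehmer_h%:~R - 5 * zeta ^+ k).
Proof.
move=> k5; have w4 := prim5_exp4 (zeta_prim_exp zeta_prim k5).
have ZA := ZAk k; pose N : algC := n%:~R; have ZN : Z N by apply: Zzeta_int.
exists (3 * N ^+ 2 - 3 * N * Ak k + Ak k ^+ 2 + 4 * (2 * N - Ak k) + 10).
  by do ?[exact: ZA | exact: ZN | exact: Zzeta_nat | apply: ZzetaD
    | apply: ZzetaN | apply: ZzetaX | apply: ZzetaM].
rewrite /lehmer_h /A_ /N; move: (zeta ^+ k) w4 => w w4.
by ring: w4.
Qed.

Lemma prod_Ak k : (0 < k < 5)%N ->
  A_ (zeta ^+ k ^+ 1) n * A_ (zeta ^+ k ^+ 2) n * A_ (zeta ^+ k ^+ 3) n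
     * A_ (zeta ^+ k ^+ 4) n = (lehmer_Delta n)%:~R.
Proof.
move=> k5; have w4 := prim5_exp4 (zeta_prim_exp zeta_prim k5).
rewrite /lehmer_Delta /A_; move: (zeta ^+ k) w4 => w w4.
by ring: w4.
Qed.

Variable p : nat.
Hypothesis p_prime : prime p.
Hypothesis p_Delta : (p %| lehmer_Delta n)%Z.

Lemma p_coprime5 : coprimez p 5.
Proof.
rewrite /coprimez /gcdz /= eqz_nat -/(coprime p 5) prime_coprime //.
rewrite dvdn_prime2 //; apply/eqP => p5; move: p_Delta; rewrite p5.
move=> /dvdzP[q qE]; have := Delta_mod5 n_not5; rewrite qE.
by rewrite modzMl.
Qed.

(** [g] is h / 5 modulo p, the future residue of zeta^k at a prime dividing p and [Ak k]. *)
Lemma exists_g : exists g : int, (p %| 5 * g - lehmer_h)%Z.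
Proof.
have [u [v uv]] := bezout_int p_coprime5.
exists (v * lehmer_h); apply/dvdzP; exists (- u * lehmer_h).
have -> : - u * lehmer_h * p = - (u * p) * lehmer_h by ring.
by rewrite -(addrK (v * 5) (u * p)) uv; ring.
Qed.

Section Above.

Variables (k : nat) (pi : algC).
Hypothesis k5 : (0 < k < 5)%N.
Hypotheses (Zpi : Z pi) (pi_nunit : ~ Zzeta_unit zeta pi).
Hypotheses (pi_p : dvd pi p%:R) (pi_A : dvd pi (Ak k)).

Lemma above_int (x : int) : dvd pi x%:~R -> (p %| x)%Z.
Proof.
move=> pix; case: (boolP (p %| x)%Z) => // npx; case: pi_nunit; split=> //.
have : coprimez p x by rewrite /coprimez /gcdz /= eqz_nat -/(coprime p _) prime_coprime.
case/bezout_int=> u [v /(congr1 (fun t : int => t%:~R : algC))].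
rewrite rmorphD !rmorphM /= mulr1z => <-.
by apply: Zdvd_add; apply: Zdvd_mull => //; apply: Zzeta_int.
Qed.

Lemma int_above (x : int) : (p %| x)%Z -> dvd pi x%:~R.
Proof. by move/(int_Zdvd zeta); apply: Zdvd_trans. Qed.

Lemma above_g (g : int) : (p %| 5 * g - lehmer_h)%Z -> dvd pi (zeta ^+ k - g%:~R).
Proof.
move=> /int_above pg; have [u [v /(congr1 (fun t : int => t%:~R : algC))]] :=
  bezout_int p_coprime5.
rewrite rmorphD !rmorphM /= mulr1z => uv.
have -> : zeta ^+ k - g%:~R = u%:~R * p%:~R * (zeta ^+ k - g%:~R)
    + v%:~R * 5%:~R * (zeta ^+ k - g%:~R) by rewrite -mulrDl uv mul1r.
apply: Zdvd_add.
  apply: Zdvd_mulr; last exact: (Zdvd_mull (Zzeta_int zeta u) pi_p).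
  by apply: ZzetaB; [apply: Zzeta_zetaX | apply: Zzeta_int].
rewrite -mulrA; apply: Zdvd_mull; first exact: Zzeta_int.
have -> : 5%:~R * (zeta ^+ k - g%:~R) =
  - (lehmer_h%:~R - 5 * zeta ^+ k) - (5 * g - lehmer_h)%:~R :> algC.
  by rewrite rmorphB rmorphM /=; ring.
by apply: Zdvd_sub => //; apply: Zdvd_opp; apply: Zdvd_trans (Ak_dvd_h k5).
Qed.

End Above.

Lemma Zdvd_subX pi x y m : Z x -> Z y -> dvd pi (x - y) -> dvd pi (x ^+ m - y ^+ m).
Proof.
move=> Zx Zy xy; rewrite subrXX; apply: Zdvd_mulr => //.
by elim/big_ind: _ => [||i _]; [apply: Zzeta0 | apply: ZzetaD |
   apply: ZzetaM; apply: ZzetaX].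
Qed.

Definition inv5 (k : nat) : nat := nth 0%N [:: 0; 1; 3; 2; 4]%N k.

Lemma zeta_inv5 k : (0 < k < 5)%N -> zeta ^+ k ^+ inv5 k = zeta.
Proof.
by case: k => [|[|[|[|[|]]]]] // _; rewrite -exprM -(expr_mod _ z5).
Qed.

Lemma above_zeta k pi (g : int) : (0 < k < 5)%N ->
    dvd pi p%:R -> dvd pi (Ak k) ->
    (p %| 5 * g - lehmer_h)%Z -> dvd pi (zeta - (g ^+ inv5 k)%:~R).
Proof.
move=> k5 pip piA /(above_g k5 pip piA) pg.
rewrite -[X in X - _](zeta_inv5 k5) rmorphXn; apply: Zdvd_subX => //.
  exact: Zzeta_zetaX.
exact: Zzeta_int.
Qed.

Definition zpol (v0 v1 v2 v3 t : int) : int :=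
  v0 + v1 * t + v2 * t ^+ 2 + v3 * t ^+ 3.

Lemma zlin_above pi (t v0 v1 v2 v3 : int) : dvd pi (zeta - t%:~R) ->
  dvd pi (zlin zeta v0%:~R v1%:~R v2%:~R v3%:~R - (zpol v0 v1 v2 v3 t)%:~R).
Proof.
move=> pit; have h m : dvd pi (zeta ^+ m - t%:~R ^+ m).
  by apply: Zdvd_subX => //; [apply: Zzeta_zeta | apply: Zzeta_int].
have -> : zlin zeta v0%:~R v1%:~R v2%:~R v3%:~R - (zpol v0 v1 v2 v3 t)%:~R =
   v1%:~R * (zeta ^+ 1 - t%:~R ^+ 1) + v2%:~R * (zeta ^+ 2 - t%:~R ^+ 2)
   + v3%:~R * (zeta ^+ 3 - t%:~R ^+ 3).
  by rewrite /zlin /zpol; ring.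
by do 2?[apply: Zdvd_add]; apply: Zdvd_mull => //; apply: Zzeta_int.
Qed.

(** The prime is d = gcd(p, [Ak k]). Were d a unit, [Ak k] and, by applying automorphisms, all its
    conjugates would be invertible modulo p, and so would their product Delta_n, which p divides.
    Since zeta is congruent to an integer modulo d, so is every element of Z[zeta], and d divides an
    integer only if p does; primality of d thus reduces to that of p. *)
Lemma exists_above k : (0 < k < 5)%N ->
  exists pi, common_prime_divisor zeta p (Ak k) pi.
Proof.
move=> k5; have Zp := Zzeta_nat zeta p.
have [d [u [v [Zu Zv dE dp dA]]]] := Zzeta_bezout zeta_prim Zp (ZAk k).
have Zd : Z d.
  by rewrite dE; apply: ZzetaD; apply: ZzetaM => //; apply: ZAk.
have nd : ~ Zzeta_unit zeta d.
  move=> [_ [q Zq qE]].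
  have p_aut j : (0 < j < 5)%N ->
      exists2 y, Z y & dvd p%:R (1 - y * A_ (zeta ^+ k ^+ j) n).
    move=> j5; have [nu nuE] := zeta_aut zeta_prim j5.
    exists (nu (v * q)); first by apply: (Zzeta_aut zeta_prim nuE); apply: ZzetaM.
    exists (nu (u * q)); first by apply: (Zzeta_aut zeta_prim nuE); apply: ZzetaM.
    have <- : nu (Ak k) = A_ (zeta ^+ k ^+ j) n.
      by rewrite A_aut rmorphXn /= nuE exprAC.
    have E : nu (u * q) * p%:R + nu (v * q) * nu (Ak k) = 1.
      transitivity (nu (d * q)); last by rewrite -qE rmorph1.
      by rewrite dE; ring.
    by apply: (canLR (addrK _)); rewrite -[LHS]E; ring.
  have [y1 Z1 d1] := p_aut 1%N isT; have [y2 Z2 d2] := p_aut 2%N isT.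
  have [y3 Z3 d3] := p_aut 3%N isT; have [y4 Z4 d4] := p_aut 4%N isT.
  have ZA j : Z (A_ (zeta ^+ k ^+ j) n) by rewrite -exprM; apply: ZAk.
  have pM a b : Z a -> dvd p%:R (1 - a) -> dvd p%:R (1 - b) -> dvd p%:R (1 - a * b).
    move=> Za da db; have -> : 1 - a * b = (1 - a) + a * (1 - b) by ring.
    by apply: Zdvd_add => //; apply: Zdvd_mull.
  have Za j y : Z y -> Z (y * A_ (zeta ^+ k ^+ j) n).
    by move=> Zy; apply: ZzetaM => //; apply: ZA.
  have := pM _ _ (ZzetaM (ZzetaM (Za _ _ Z1) (Za _ _ Z2)) (Za _ _ Z3))
    (pM _ _ (ZzetaM (Za _ _ Z1) (Za _ _ Z2)) (pM _ _ (Za _ _ Z1) d1 d2) d3) d4.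
  have : dvd p%:R (y1 * y2 * y3 * y4 * (lehmer_Delta n)%:~R).
    apply: Zdvd_mull; last exact: (int_Zdvd zeta p_Delta).
    by do ?[apply: ZzetaM => //].
  rewrite -(prod_Ak k5) => h1 h2; have := Zdvd_add h1 h2.
  set x := (X in dvd _ X); have -> : x = 1 by rewrite /x; ring.
  move=> /(@Zdvd_nat _ zeta_prim p 1); rewrite dvdn1 => /eqP p1.
  by move: p_prime; rewrite p1.
exists d; split=> //; split=> //.
  by move=> d0; case: dp => q _; rewrite d0 mul0r => /eqP; rewrite pnatr_eq0; case: p p_prime.
have [g gP] := exists_g; have dz := above_zeta k5 dp dA gP.
have red x : Z x -> exists a : int, dvd d (x - a%:~R).
  move=> /(ZzetaP zeta_prim)[v0 [v1 [v2 [v3 ->]]]].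
  by exists (zpol v0 v1 v2 v3 (g ^+ inv5 k)); apply: zlin_above.
move=> x y Zx Zy dxy; have [a da] := red x Zx; have [b db] := red y Zy.
have : (p %| a * b)%Z.
  apply: (above_int Zd nd dp); rewrite rmorphM /=.
  have -> : a%:~R * b%:~R = x * y - ((x - a%:~R) * y + a%:~R * (y - b%:~R)) by ring.
  apply: Zdvd_sub => //; apply: Zdvd_add; first exact: Zdvd_mulr.
  by apply: Zdvd_mull => //; apply: Zzeta_int.
rewrite !dvdzE abszM Euclid_dvdM // => /orP[pa|pb]; [left|right].
  by rewrite -(subrK a%:~R x); apply: Zdvd_add => //; apply: int_above.
by rewrite -(subrK b%:~R y); apply: Zdvd_add => //; apply: int_above.
Qed.

End SplitPrimes.

Lemma logn_prod p m (f : 'I_m -> nat) : (forall i, (0 < f i)%N) ->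
  logn p (\prod_i f i)%N = (\sum_i logn p (f i))%N.
Proof.
move=> f0; suff [] : (0 < \prod_i f i)%N /\
    logn p (\prod_i f i)%N = (\sum_i logn p (f i))%N by [].
elim/big_rec2: _ => [|i x y _ [x0 <-]]; first by rewrite logn1.
by rewrite muln_gt0 f0 x0 lognM.
Qed.

Section SplitValuation.

Variables (zeta : algC) (n : int).
Hypothesis zeta_prim : 5.-primitive_root zeta.
Hypothesis n_not5 : ~~ (5 %| n)%Z.

Let z5 : zeta ^+ 5 = 1 := prim_expr_order zeta_prim.
Let z4 := prim5_exp4 zeta_prim.

Notation Z := (Zzeta zeta).
Notation dvd := (Zzeta_dvd zeta).
Notation Ak k := (A_ (zeta ^+ k) n).

Variable p : nat.
Hypothesis p_prime : prime p.
Hypothesis p_Delta : (p %| lehmer_Delta n)%Z.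

Notation above k pi := (common_prime_divisor zeta p (Ak k) pi).

Let FpE (x : int) : (p %| x)%Z = (x%:~R == 0 :> 'F_p).
Proof. by rewrite (dvdz_pcharf (pchar_Fp p_prime)). Qed.

Lemma five_Fp : 5 != 0 :> 'F_p.
Proof.
have -> : 5 = (5%:Z)%:~R :> 'F_p by [].
have := p_coprime5 n_not5 p_prime p_Delta.
by rewrite /coprimez /gcdz /= eqz_nat -/(coprime p 5) prime_coprime // -FpE dvdzE.
Qed.

(** Reducing 1 + zeta + ... + zeta^4 = 0 at a prime above p shows that g is a fifth root of 1 in
    ['F_p]. It is not 1, as that would give 5 = 0. *)
Lemma exists_prim_g :
  exists2 g : int, (p %| 5 * g - lehmer_h n)%Z & 5.-primitive_root (g%:~R : 'F_p).
Proof.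
have [g gP] := exists_g n_not5 p_prime p_Delta; exists g => //.
have k1 : (0 < 1 < 5)%N by [].
have [pi [[Zpi _ npi _] pip piA]] := exists_above zeta_prim n_not5 p_prime p_Delta k1.
have /= := above_zeta zeta_prim n_not5 p_prime p_Delta k1 pip piA gP.
rewrite /inv5 /= expr1 => zg.
have h m : dvd pi (zeta ^+ m - g%:~R ^+ m).
  by apply: Zdvd_subX zg; [apply: Zzeta_zeta | apply: Zzeta_int].
have : (p %| 1 + g + g ^+ 2 + g ^+ 3 + g ^+ 4)%Z.
  apply: (above_int p_prime Zpi npi pip).
  have -> : (1 + g + g ^+ 2 + g ^+ 3 + g ^+ 4)%:~R =
    - ((zeta ^+ 1 - g%:~R ^+ 1) + (zeta ^+ 2 - g%:~R ^+ 2)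
       + (zeta ^+ 3 - g%:~R ^+ 3) + (zeta ^+ 4 - g%:~R ^+ 4)) :> algC.
    by ring: z4.
  by apply: Zdvd_opp; do 3!apply: Zdvd_add => //.
rewrite FpE !rmorphD /= !rmorphXn /= mulr1z.
move: (g%:~R : 'F_p) => x /eqP x4.
have x5 : x ^+ 5 = 1.
  apply/eqP; rewrite -subr_eq0; apply/eqP.
  have -> : x ^+ 5 - 1 = (x - 1) * (1 + x + x ^+ 2 + x ^+ 3 + x ^+ 4) by ring.
  by rewrite x4 mulr0.
have [m xm] := prim_order_exists (isT : (0 < 5)%N) x5.
have /primeP[_ h5] : prime 5 by [].
move=> /h5/pred2P[m1|m5]; last by rewrite -m5.
move: xm x4; rewrite m1 => /prim_expr_order; rewrite expr1 => ->.
have -> : 1 + 1 + 1 ^+ 2 + 1 ^+ 3 + 1 ^+ 4 = 5 :> 'F_p by ring.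
by move/eqP; rewrite (negPf five_Fp).
Qed.

Lemma p_mod5 : (p %% 5 = 1)%N.
Proof.
have [g _ gP] := exists_prim_g; have p0 := prime_gt0 p_prime.
have : (g%:~R : 'F_p) ^+ p = g%:~R ^+ 1 by have := expf_card (g%:~R : 'F_p); rewrite card_Fp.
by move/eqP; rewrite (eq_prim_root_expr gP) => /eqP.
Qed.

(** Divisibility by a prime above p becomes the vanishing in ['F_p] of a polynomial at the residue
    of zeta, which is a power of g. *)
Lemma above_iff (g : int) k pi (v0 v1 v2 v3 : int) :
    (p %| 5 * g - lehmer_h n)%Z -> (0 < k < 5)%N -> above k pi ->
  dvd pi (zlin zeta v0%:~R v1%:~R v2%:~R v3%:~R) <->
  (p %| zpol v0 v1 v2 v3 (g ^+ inv5 k))%Z.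
Proof.
move=> gP k5 [[Zpi _ npi _] pip piA].
have zg := above_zeta zeta_prim n_not5 p_prime p_Delta k5 pip piA gP.
have zl := zlin_above v0 v1 v2 v3 zg; split=> h.
  apply: (above_int p_prime Zpi npi pip).
  rewrite -[X in dvd _ X](subKr (zlin zeta v0%:~R v1%:~R v2%:~R v3%:~R)).
  exact: Zdvd_sub.
rewrite -(subrK (zpol v0 v1 v2 v3 (g ^+ inv5 k))%:~R (zlin _ _ _ _ _)).
by apply: Zdvd_add => //; exact: (int_above pip h).
Qed.

Lemma inv5_inj j k : (0 < j < 5)%N -> (0 < k < 5)%N ->
  inv5 j = inv5 k %[mod 5] -> j = k.
Proof. by case: j k => [|[|[|[|[|]]]]] // [|[|[|[|[|]]]]]. Qed.

(** A common prime of [Ak j] and [Ak k] would give zeta the residues g^(inv5 j) and g^(inv5 k);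
    these differ when j and k do, because g has order 5. *)
Lemma above_distinct j k pi : (0 < j < 5)%N -> (0 < k < 5)%N -> above k pi ->
  dvd pi (Ak j) -> j = k.
Proof.
move=> j5 k5 [[Zpi _ npi _] pip piA] piAj; have [g gP prim_g] := exists_prim_g.
have zk := above_zeta zeta_prim n_not5 p_prime p_Delta k5 pip piA gP.
have zj := above_zeta zeta_prim n_not5 p_prime p_Delta j5 pip piAj gP.
apply: inv5_inj => //; apply/eqP; rewrite -(eq_prim_root_expr prim_g) -subr_eq0.
rewrite -!rmorphXn -rmorphB /= -FpE; apply: (above_int p_prime Zpi npi pip).
rewrite rmorphB /= -[X in dvd _ X](subrKA zeta) -opprB addrC.
exact: Zdvd_sub zk zj.
Qed.

(** This replaces the factorisation of p into four distinct primes. The coordinates of [y] define a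
    polynomial of degree at most 3 that vanishes at the four primitive fifth roots g^j of ['F_p], so
    its coefficients are 0 by [fourier_zeta]. As [inv5] is an involution, the root g^j belongs to
    the prime of index [inv5 j]. *)
Lemma Zdvd_p_above y : Z y ->
    (forall k, (0 < k < 5)%N -> exists2 pi, above k pi & dvd pi y) ->
  dvd p%:R y.
Proof.
move=> /(ZzetaP zeta_prim)[v0 [v1 [v2 [v3 ->]]]] H.
have [g gP prim_g] := exists_prim_g.
pose P (x : 'F_p) := v0%:~R + v1%:~R * x + v2%:~R * x ^+ 2 + v3%:~R * x ^+ 3
  + 0 * x ^+ 4.
have P0 (j : 'I_4) : P (g%:~R ^+ j.+1) = 0.
  have j5 : (0 < inv5 j.+1 < 5)%N by move: j => [[|[|[|[|]]]] ?].
  have jj : inv5 (inv5 j.+1) = j.+1 by move: j {j5} => [[|[|[|[|]]]] ?].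
  have [pi abv /(above_iff _ _ _ _ gP j5 abv)] := H _ j5.
  rewrite jj FpE => /eqP E; rewrite -[RHS]E /P /zpol mul0r addr0.
  by rewrite !rmorphD !rmorphM /= !(rmorphXn intr).
have pv i : (i < 4)%N -> (p %| [:: v0; v1; v2; v3]`_i)%Z.
  move=> i4; have := fourier_zeta v0%:~R v1%:~R v2%:~R v3%:~R 0
    (prim5_exp4 prim_g) i4.
  rewrite /= big1 => [/esym/eqP|j _]; last first.
    by have := P0 j; rewrite /P => ->; rewrite mul0r.
  rewrite mulf_eq0 (negPf five_Fp) subr0 /= FpE.
  by move: i i4 => [|[|[|[|]]]].
have d v : (p %| v)%Z -> dvd p%:R v%:~R by move/(int_Zdvd zeta).
rewrite /zlin; have Zz m := Zzeta_zetaX zeta m.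
apply: Zdvd_add; [apply: Zdvd_add; [apply: Zdvd_add|]|].
- exact: d (pv 0%N isT).
- by apply: Zdvd_mulr (d _ (pv 1%N isT)); apply: (Zz 1%N).
- by apply: Zdvd_mulr (d _ (pv 2%N isT)).
- by apply: Zdvd_mulr (d _ (pv 3%N isT)).
Qed.

Lemma above_dvd k pi pi' y : (0 < k < 5)%N -> above k pi -> above k pi' -> Z y ->
  dvd pi y -> dvd pi' y.
Proof.
move=> k5 ab ab' /(ZzetaP zeta_prim)[v0 [v1 [v2 [v3 ->]]]].
have [g gP _] := exists_prim_g.
by move=> /(above_iff _ _ _ _ gP k5 ab)/(above_iff _ _ _ _ gP k5 ab').
Qed.

Lemma above_assoc k pi pi' : (0 < k < 5)%N -> above k pi -> above k pi' ->
  zval zeta pi pi' 1.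
Proof.
move=> k5 ab ab'; have [[Zpi /eqP pi0 npi pip] _ _] := ab.
have [[Zpi' _ _ _] _ _] := ab'.
have [s Zs sE] : dvd pi pi' by apply: (above_dvd k5 ab' ab) => //; apply: Zdvd_refl.
have [t Zt tE] : dvd pi' pi by apply: (above_dvd k5 ab ab') => //; apply: Zdvd_refl.
exists s; last by rewrite expr1.
split=> // -[q Zq qE]; apply: npi; split=> //; exists (q * t).
  exact: ZzetaM.
apply: (mulfI pi0); rewrite mulr1 {1}tE sE qE; ring.
Qed.

Lemma above_ndvd j k pi pi' : (0 < j < 5)%N -> (0 < k < 5)%N -> j <> k ->
  above k pi -> above j pi' -> ~ dvd pi pi'.
Proof.
move=> j5 k5 jk ab [_ _ A'] h; apply: jk; apply: above_distinct j5 k5 ab _.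
exact: Zdvd_trans A'.
Qed.

(** The prime p is unramified. Let y be the product of primes above p of the three other indices.
    Then pi * y is divisible by a prime of each index, hence by p; if pi^2 divided p, then pi would
    divide y. *)
Lemma zval_above_p k pi : (0 < k < 5)%N -> above k pi -> zval zeta pi p%:R 1.
Proof.
move=> k5 ab; have [P [s Zs sE] piA] := ab; have [Zpi /eqP pi0 _ _] := P.
exists s; last by rewrite expr1.
split=> // -[t Zt tE].
have ex j : (0 < j < 5)%N -> {q' | above j q'}.
  by move=> j5; apply: cid; apply: exists_above.
pose q j := if (0 < j < 5)%N =P true is ReflectT j5 then
  (if j == k then 1 else sval (ex j j5)) else 1.
have qE j (j5 : (0 < j < 5)%N) : j <> k -> above j (q j).
  rewrite /q; case: eqP => // j5' /eqP/negPf->; exact: (svalP (ex j j5')).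
have Zq j : Z (q j).
  rewrite /q; case: eqP => [j5|_]; last exact: Zzeta1.
  by case: ifP => _; [apply: Zzeta1 | case: (ex j j5) => ? [[]]].
have nq j : ~ dvd pi (q j).
  case: (boolP ((0 < j < 5)%N && (j != k))) => [/andP[j5 /eqP jk]|].
    exact: above_ndvd j5 k5 jk ab (qE j j5 jk).
  rewrite negb_and /q => h; case: eqP => [j5|_]; last exact: prime_ndvd1 P.
  by move: h; rewrite j5 /= negbK => ->; apply: prime_ndvd1 P.
pose y := q 1%N * q 2%N * q 3%N * q 4%N.
have Zy : Z y by do !apply: ZzetaM.
have ny : ~ dvd pi y.
  case/(prime_dvdM P (ZzetaM (ZzetaM (Zq 1%N) (Zq 2%N)) (Zq 3%N)) (Zq 4%N)) => [|/nq//].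
  case/(prime_dvdM P (ZzetaM (Zq 1%N) (Zq 2%N)) (Zq 3%N)) => [|/nq//].
  by case/(prime_dvdM P (Zq 1%N) (Zq 2%N)) => /nq.
have [|j j5|r Zr rE] := @Zdvd_p_above (pi * y).
- exact: ZzetaM.
- case: (eqVneq j k) => [->|/eqP jk].
    by exists pi => //; apply: Zdvd_mulr => //; apply: Zdvd_refl.
  exists (q j); first exact: qE.
  apply: Zdvd_mull => //; rewrite /y; move: j j5 jk => [|[|[|[|[|]]]]] // _ _.
  + by do 3!apply: Zdvd_mulr => //; apply: Zdvd_refl.
  + by do 2!apply: Zdvd_mulr => //; apply: Zdvd_mull => //; apply: Zdvd_refl.
  + by apply: Zdvd_mulr => //; apply: Zdvd_mull => //; [apply: ZzetaM|apply: Zdvd_refl].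
  + by apply: Zdvd_mull => //; [do !apply: ZzetaM|apply: Zdvd_refl].
apply: ny; exists (t * r); first exact: ZzetaM.
by apply: (mulfI pi0); rewrite rE sE tE; ring.
Qed.

Lemma zval_above_nat k pi m : (0 < k < 5)%N -> above k pi -> (0 < m)%N ->
  zval zeta pi m%:R (logn p m).
Proof.
move=> k5 ab m0; have [P pip _] := ab; have [Zpi _ npi _] := P.
have [m' cop ->] := pfactor_coprime p_prime m0.
rewrite logn_Gauss // ?pfactorK // natrM natrX.
rewrite -[X in zval _ _ _ X]add0n -[X in (_ + X)%N]muln1.
apply: zvalM => //; last exact: zvalX (zval_above_p k5 ab).
apply: zval0; first exact: Zzeta_nat.
move=> /(above_int (x := Posz m') p_prime Zpi npi pip); rewrite dvdzE /= => pm.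
by move: cop; rewrite prime_coprime // pm.
Qed.

(** The conjugates of [Ak k] have product Delta_n, and pi divides only one of them, which therefore
    carries the whole valuation. *)
Lemma zval_above_A k pi : (0 < k < 5)%N -> above k pi ->
  zval zeta pi (Ak k) (logn p `|lehmer_Delta n|).
Proof.
move=> k5 ab; have [P _ _] := ab.
have nA j : (1 < j < 5)%N -> ~ dvd pi (A_ (zeta ^+ k ^+ j) n).
  move=> j5; rewrite -exprM -(expr_mod _ z5) => h.
  have := above_distinct _ k5 ab h.
  by move: k j k5 j5 {P ab h} => [|[|[|[|[|]]]]] // [|[|[|[|[|]]]]] //= _ _ /(_ isT).
have ZA j : Z (A_ (zeta ^+ k ^+ j) n) by rewrite -exprM; apply: ZAk.
have Z1 := ZAk zeta n k; have Z2 := ZzetaM Z1 (ZA 2%N).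
apply: (zval_cancel P Z1 (ZA 2%N) (nA 2%N isT)).
apply: (zval_cancel P Z2 (ZA 3%N) (nA 3%N isT)).
apply: (zval_cancel P (ZzetaM Z2 (ZA 3%N)) (ZA 4%N) (nA 4%N isT)).
have := prod_Ak n zeta_prim k5; rewrite expr1 => ->.
have [u [Zu u1] ->] : exists2 u, Z u /\ dvd u 1 &
    (lehmer_Delta n)%:~R = u * (`|lehmer_Delta n|%N)%:R.
  exists (if 0 <= lehmer_Delta n then 1 else -1).
    case: ifP => _; first by split; [apply: Zzeta1 | apply: Zdvd_refl].
    split; first by apply: ZzetaN; apply: Zzeta1.
    by exists (-1); [apply: ZzetaN; apply: Zzeta1 | rewrite mulrNN mulr1].
  have -> : (`|lehmer_Delta n|%N)%:R = `|lehmer_Delta n|%:~R :> algC by [].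
  by case: ger0P => _; rewrite ?mul1r // mulN1r rmorphN opprK.
rewrite -[logn _ _]add0n; apply: zvalM => //; first exact: zval_unit.
apply: (zval_above_nat k5 ab); rewrite absz_gt0.
by apply/eqP => D0; have := Delta_mod5 n_not5; rewrite D0.
Qed.

Lemma zval_above_A0 j k pi : (0 < j < 5)%N -> (0 < k < 5)%N -> j <> k ->
  above k pi -> zval zeta pi (Ak j) 0.
Proof.
move=> j5 k5 jk ab; apply: zval0; first exact: ZAk.
by move=> h; apply: jk; apply: above_distinct h.
Qed.

Lemma zval_choice N j k pi m (ps : 'I_m -> nat) (pis : 'I_m -> algC) :
    (0 < j < 5)%N -> (0 < k < 5)%N -> above k pi ->
    prime_element_choice zeta N (Ak j) ps pis ->
  zval zeta pi (\prod_i pis i) (if j == k then logn p N else 0%N).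
Proof.
move=> j5 k5 ab [NE ps_pr pisP]; have [P pip _] := ab; have [Zpi _ npi _] := P.
have -> : (if j == k then logn p N else 0)%N =
    \sum_(i < m) (if (j == k) && (ps i == p) then 1 else 0)%N.
  case: eqP => _ /=; last by rewrite big1.
  rewrite NE logn_prod => [|i]; last exact: prime_gt0.
  by apply: eq_bigr => i _; rewrite logn_prime // eq_sym; case: eqP.
apply: zval_prod => // i; have [Pi pi_ps piA] := pisP i.
have [Zi _ _ _] := Pi.
have [psE|psE] := eqVneq (ps i) p; last first.
  rewrite andbF; apply: zval0 => // h.
  have : (p %| Posz (ps i))%Z.
    apply: (above_int (x := Posz (ps i)) p_prime Zpi npi pip).
    exact: Zdvd_trans pi_ps.
  by rewrite dvdzE /= dvdn_prime2 // eq_sym (negPf psE).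
rewrite psE in pi_ps; case: eqP => /= [jk|jk].
  by apply: above_assoc k5 ab _; rewrite -jk.
by apply: zval0 => //; apply: above_ndvd j5 k5 jk ab _.
Qed.

End SplitValuation.

(** * Fifth powers and residues *)

Section Global.

Variables (zeta : algC) (n : int).
Hypothesis zeta_prim : 5.-primitive_root zeta.
Hypothesis n_not5 : ~~ (5 %| n)%Z.


Notation Z := (Zzeta zeta).
Notation dvd := (Zzeta_dvd zeta).
Notation Ak k := (A_ (zeta ^+ k) n).
Notation above p k pi := (common_prime_divisor zeta p (Ak k) pi).

Definition Delta_primes (K : nat) : Prop :=
  forall p, prime p -> (p %| K)%N -> (p %| lehmer_Delta n)%Z.

Lemma Delta_primesM K L : Delta_primes K -> Delta_primes L -> Delta_primes (K * L).
Proof. by move=> hK hL p pp; rewrite Euclid_dvdM // => /orP[/hK|/hL]; apply. Qed.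

Lemma Delta_primesX K m : Delta_primes K -> Delta_primes (K ^ m).
Proof. by move=> hK p pp; rewrite Euclid_dvdX // => /andP[/hK h _]; apply: h. Qed.

Lemma Delta_primesS K L : (K %| L)%N -> Delta_primes L -> Delta_primes K.
Proof. by move=> KL hL p pp pK; apply: hL => //; apply: dvdn_trans KL. Qed.

Lemma Delta_primes_ind (Q : nat -> Prop) :
    Q 1%N ->
    (forall p K, prime p -> (p %| lehmer_Delta n)%Z -> (0 < K)%N ->
       Delta_primes K -> Q K -> Q (p * K)%N) ->
  forall K, (0 < K)%N -> Delta_primes K -> Q K.
Proof.
move=> Q1 QM; elim/ltn_ind => K IH K0 hK.
have [K1|K1] := leqP K 1; first by have -> : K = 1%N by lia.
have pp := pdiv_prime K1; have /dvdnP[K' KE] := pdiv_dvd K.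
have K'0 : (0 < K')%N by move: K0; rewrite KE muln_gt0 => /andP[].
have hK' : Delta_primes K' by apply: Delta_primesS hK; rewrite KE dvdn_mulr.
rewrite KE mulnC; apply: QM => //; first by apply: hK => //; apply: pdiv_dvd.
apply: IH => //; rewrite [X in (_ < X)%N]KE -[X in (X < _)%N]muln1 ltn_pmul2l //.
exact: prime_gt1.
Qed.

Lemma Delta_primes_mod5 K : (0 < K)%N -> Delta_primes K -> (K %% 5 = 1)%N.
Proof.
move: K; apply: Delta_primes_ind => // p K pp pD K0 _ IH.
by rewrite -modnMml (p_mod5 zeta_prim n_not5 pp pD) mul1n.
Qed.

Lemma zval_div pi x y r m : Zzeta_prime zeta pi -> Z y ->
    zval zeta pi (x * y) r -> zval zeta pi x m ->
  (m <= r)%N /\ zval zeta pi y (r - m).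
Proof.
move=> P Zy vxy [t [Zt nt] xE]; have [Zpi /eqP pi0 _ _] := P.
have mr : (m <= r)%N.
  apply: (zval_dvd P vxy); rewrite xE -mulrA; exists (t * y) => //.
  exact: ZzetaM.
split=> //; apply: (zval_cancel P Zy Zt nt).
case: vxy => s sP sE; exists s => //.
have pm0 : pi ^+ m != 0 by rewrite expf_neq0.
apply: (mulfI pm0); rewrite [RHS]mulrA -exprD subnKC // -sE xE; ring.
Qed.

(** Local divisibility implies divisibility: [Zdvd_p_above] splits off one prime p of K at a time,
    and the valuation of p is then cancelled on both sides. *)
Lemma nat_Zdvd_above K : (0 < K)%N -> Delta_primes K -> forall y, Z y ->
    (forall p k pi, prime p -> (p %| K)%N -> (0 < k < 5)%N -> above p k pi ->
       dvd (pi ^+ logn p K) y) ->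
  dvd K%:R y.
Proof.
move: K; apply: Delta_primes_ind => [y Zy _|p K pp pD K0 hK IH y Zy H].
  by exists y => //; rewrite mul1r.
have [y' Zy' yE] : dvd p%:R y.
  apply: (Zdvd_p_above zeta_prim n_not5 pp pD Zy) => k k5.
  have [pi ab] := exists_above zeta_prim n_not5 pp pD k5.
  exists pi => //; have [[Zpi _ _ _] _ _] := ab.
  apply: Zdvd_trans (H p k pi pp (dvdn_mulr _ (dvdnn p)) k5 ab).
  rewrite (lognM _ (prime_gt0 pp) K0) (logn_prime _ pp) eqxx exprS.
  by apply: Zdvd_mulr; [apply: ZzetaX | apply: Zdvd_refl].
rewrite natrM yE; apply: Zdvd_mul; first exact: Zdvd_refl.
apply: IH => // q k pi qp qK k5 ab; have qD := hK q qp qK.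
have [P _ _] := ab; have [Zpi /eqP pi0 _ _] := P.
have [t [Zt nt] tE] := zval_above_nat zeta_prim n_not5 qp qD k5 ab (prime_gt0 pp).
apply: (Zdvd_cancel P Zy' Zt nt).
have [s Zs sE] := H q k pi qp (dvdn_mull _ qK) k5 ab.
exists s => //; have pe0 : pi ^+ logn q p != 0 by rewrite expf_neq0.
apply: (mulfI pe0); rewrite [RHS]mulrA -exprD -(lognM _ (prime_gt0 pp) K0) -sE yE tE; ring.
Qed.

Section Descent.

Variable theta : algC.
Hypothesis Ztheta : Z theta.
Hypothesis theta_free : forall p k pi, prime p -> (p %| lehmer_Delta n)%Z ->
  (0 < k < 5)%N -> above p k pi -> exists2 e, (e < 5)%N & zval zeta pi theta e.

(** One prime p of the denominator is removed at a time. With y = p K x, the element 5 y^5 theta is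
    divisible by p^5, hence by pi^5 for each pi above p. If pi did not divide y, then pi^5 would
    divide theta, whose valuation is below 5. So every pi divides y, and p does. *)
Lemma fifth_root_descent K : (0 < K)%N -> Delta_primes K -> forall x,
  Z (K%:R * x) -> Z (5 * x ^+ 5 * theta) -> Z x.
Proof.
move: K; apply: Delta_primes_ind => [x|p K pp pD K0 hK IH x ZKx Z5].
  by rewrite mul1r.
apply: IH => //; set x' := K%:R * x; pose y := p%:R * x'.
have Zy : Z y by rewrite /y /x' mulrA -natrM.
have p0 : p%:R != 0 :> algC by rewrite pnatr_eq0 -lt0n prime_gt0.
have [q Zq yE] : dvd p%:R y.
  apply: (Zdvd_p_above zeta_prim n_not5 pp pD Zy) => k k5.
  have [pi ab] := exists_above zeta_prim n_not5 pp pD k5.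
  exists pi => //; have [P pip _] := ab; have [Zpi _ npi _] := P.
  have [e e5 ve] := theta_free pp pD k5 ab.
  apply: contrapT => npiy.
  have n5y : ~ dvd pi (5 * y ^+ 5).
    case/(prime_dvdM P (Zzeta_nat zeta 5) (ZzetaX 5 Zy)).
      move=> /(above_int (x := 5) pp Zpi npi pip).
      have := p_coprime5 n_not5 pp pD.
      rewrite /coprimez /gcdz /= eqz_nat -/(coprime p 5) prime_coprime //.
      by rewrite dvdzE => /negPf->.
    by move/(prime_dvdX P Zy).
  suff : dvd (pi ^+ 5) theta by move=> /(zval_dvd P ve); rewrite leqNgt e5.
  apply: (Zdvd_cancel P Ztheta _ n5y).
    by apply: ZzetaM; [apply: Zzeta_nat | apply: ZzetaX].
  have [s Zs sE] := pip.
  exists (s ^+ 5 * (K%:R ^+ 5 * (5 * x ^+ 5 * theta))).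
    apply: ZzetaM; first exact: ZzetaX.
    by apply: ZzetaM => //; apply: ZzetaX; apply: Zzeta_nat.
  by rewrite /y /x' sE; ring.
by move: yE => /(mulfI p0) ->.
Qed.

End Descent.

End Global.

(** * Residues modulo 1 - zeta and the normalising units *)

Section Residue.

Variable zeta : algC.
Hypothesis zeta_prim : 5.-primitive_root zeta.

Let z4 := prim5_exp4 zeta_prim.

Notation Z := (Zzeta zeta).
Notation dvd := (Zzeta_dvd zeta).

(** Comparing coordinates in (1 - zeta) q = x gives v2 = 2 v3, v1 = 3 v3, v0 = 4 v3 and x = 5 v3.
    The case v3 = 1 is the cofactor in [lambda_dvd5]. *)
Lemma lambda_Zdvd_int (x : int) : dvd (1 - zeta) x%:~R -> (5 %| x)%Z.
Proof.
case=> q /(ZzetaP zeta_prim)[v0 [v1 [v2 [v3 ->]]]] E.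
have Q (v : int) : v%:~R \in Crat by apply: rpred_int.
have h k (k4 : (k < 4)%N) := (fourier_rat zeta_prim (Q (v0 + v3 - x))
  (Q (v1 - v0 + v3)) (Q (v2 - v1 + v3)) (Q (v3 + v3 - v2)) (Q 0) k4).1.
have E0 : zlin zeta (v0 + v3 - x)%:~R (v1 - v0 + v3)%:~R (v2 - v1 + v3)%:~R
    (v3 + v3 - v2)%:~R + 0%:~R * zeta ^+ 4 = 0.
  transitivity ((1 - zeta) * zlin zeta v0%:~R v1%:~R v2%:~R v3%:~R - x%:~R).
    by rewrite /zlin; ring: z4.
  by rewrite -E subrr.
have /intr_inj e0 := h 0%N isT E0; have /intr_inj e1 := h 1%N isT E0.
have /intr_inj e2 := h 2%N isT E0; have /intr_inj e3 := h 3%N isT E0.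
by apply/dvdzP; exists v3; lia.
Qed.

Lemma lambda_dvd5 : dvd (1 - zeta) 5.
Proof.
exists (4 + 3 * zeta + 2 * zeta ^+ 2 + zeta ^+ 3); last by ring: z4.
by do ?[exact: Zzeta_nat | exact: Zzeta_zeta | apply: ZzetaD | apply: ZzetaX
  | apply: ZzetaM].
Qed.

Lemma lambda_zeta k : dvd (1 - zeta) (zeta ^+ k - 1).
Proof.
have h : dvd (1 - zeta) (zeta - 1).
  have -> : zeta - 1 = - (1 - zeta) by ring.
  by apply: Zdvd_opp; apply: Zdvd_refl.
by have := Zdvd_subX k (Zzeta_zeta zeta) (Zzeta1 zeta) h; rewrite expr1n.
Qed.

Lemma lambda_residue (v0 v1 v2 v3 : int) :
  dvd (1 - zeta) (zlin zeta v0%:~R v1%:~R v2%:~R v3%:~R - (v0 + v1 + v2 + v3)%:~R).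
Proof.
have -> : zlin zeta v0%:~R v1%:~R v2%:~R v3%:~R - (v0 + v1 + v2 + v3)%:~R =
    v1%:~R * (zeta ^+ 1 - 1) + v2%:~R * (zeta ^+ 2 - 1) + v3%:~R * (zeta ^+ 3 - 1).
  by rewrite /zlin; ring.
have h v k : dvd (1 - zeta) (v%:~R * (zeta ^+ k - 1)).
  by apply: Zdvd_mull; [apply: Zzeta_int | apply: lambda_zeta].
by do 2?[apply: Zdvd_add].
Qed.

(** The square root of 5 is 1 + 2 zeta + 2 zeta^4 up to a sign that depends on zeta, so phi is 1 +
    zeta + zeta^4 or -zeta - zeta^4. Both have residue 3, since -2 = 3 modulo 5, and both have
    inverse phi - 1. *)
Lemma golden_unit : let phi := (1 + sqrtC 5) / 2 : algC in
  [/\ Z phi, dvd phi 1 & dvd (1 - zeta) (phi - 3)].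
Proof.
move=> phi; have : phi = 1 + zeta + zeta ^+ 4 \/ phi = - zeta - zeta ^+ 4.
  have : (sqrtC 5 : algC) ^+ 2 == (1 + 2 * zeta + 2 * zeta ^+ 4) ^+ 2.
    by rewrite sqrtCK; apply/eqP; ring: z4.
  rewrite eqf_sqr /phi => /orP[] /eqP->; [by left; field | by right; field].
have Zz k := Zzeta_zetaX zeta k; have Z1 := Zzeta1 zeta.
have Zzeta : Z zeta by apply: (Zz 1%N).
have Zphi : phi = 1 + zeta + zeta ^+ 4 \/ phi = - zeta - zeta ^+ 4 -> Z phi.
  by case=> ->; do ?[exact: Z1 | exact: Zz | exact: Zzeta | apply: ZzetaN | apply: ZzetaD].
move=> phiE; split; first exact: Zphi.
  exists (phi - 1); first by apply: ZzetaB => //; apply: Zphi.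
  by case: phiE => ->; ring: z4.
have h1 := lambda_zeta 1; have h4 := lambda_zeta 4; have h5 := lambda_dvd5.
case: phiE => ->.
  have -> : 1 + zeta + zeta ^+ 4 - 3 = (zeta ^+ 1 - 1) + (zeta ^+ 4 - 1) by ring.
  exact: Zdvd_add.
have -> : - zeta - zeta ^+ 4 - 3 = - (zeta ^+ 1 - 1) - (zeta ^+ 4 - 1) - 5 by ring.
by apply: Zdvd_sub => //; apply: Zdvd_sub => //; apply: Zdvd_opp.
Qed.

(** The residues 1, -1, 2, -2 of [lam] meet the residues 1, -1, 3, -3 of the unit, and each product
    is 1 modulo 5. *)
Lemma u_unit lam : Z lam -> ~ dvd (1 - zeta) lam ->
  [/\ Z (u_ zeta lam), dvd (u_ zeta lam) 1 & dvd (1 - zeta) (u_ zeta lam * lam - 1)].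
Proof.
move=> Zlam nlam; have [Zphi phi1 phi3] := golden_unit; rewrite /u_.
have Z1 := Zzeta1 zeta; have h5 := lambda_dvd5.
case: asboolP => [r1|n1]; first by rewrite mul1r; split=> //; apply: Zdvd_refl.
case: asboolP => [r1|n2].
  split; [exact: ZzetaN|by exists (-1); rewrite ?mulrNN ?mulr1 //; apply: ZzetaN|].
  have -> : -1 * lam - 1 = - (lam - -1) by ring.
  exact: Zdvd_opp.
case: asboolP => [r1|n3].
  split=> //; set phi := _ / _.
  have -> : phi * lam - 1 = phi * (lam - 2) + 2 * (phi - 3) + 5 by ring.
  apply: Zdvd_add => //; apply: Zdvd_add; first exact: Zdvd_mull.
  by apply: Zdvd_mull => //; apply: Zzeta_nat.
case: asboolP => [r1|n4].
  split; first exact: ZzetaN.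
    by case: phi1 => q Zq qE; exists (- q); [apply: ZzetaN | rewrite mulrNN].
  set phi := _ / _.
  have -> : - phi * lam - 1 = - (phi * (lam - - 2)) + 2 * (phi - 3) + 5 by ring.
  apply: Zdvd_add => //; apply: Zdvd_add; first by apply: Zdvd_opp; apply: Zdvd_mull.
  by apply: Zdvd_mull => //; apply: Zzeta_nat.
exfalso; have [v0 [v1 [v2 [v3 lamE]]]] := ZzetaP zeta_prim Zlam.
have := lambda_residue v0 v1 v2 v3; rewrite -lamE; set s := v0 + v1 + v2 + v3 => hs.
have res (r : int) : (5 %| s - r)%Z -> dvd (1 - zeta) (lam - r%:~R).
  move=> /(int_Zdvd zeta)/(Zdvd_trans h5) hr.
  have -> : lam - r%:~R = (lam - s%:~R) + (s - r)%:~R by ring.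
  exact: Zdvd_add.
have : (5 %| s - 0)%Z \/ (5 %| s - 1)%Z \/ (5 %| s - -1)%Z \/ (5 %| s - 2)%Z
       \/ (5 %| s - -2)%Z.
  have := divz_eq s 5; have := modz_ge0 s (isT : 5%:Z != 0).
  have := ltz_pmod s (isT : 0 < 5%:Z).
  move: (s %% 5)%Z (s %/ 5)%Z => r q r5 r0' sE.
  have : r = 0 \/ r = 1 \/ r = 4 \/ r = 2 \/ r = 3 by lia.
  move: sE => -> [->|[->|[->|[->|->]]]].
  - by left; apply/dvdzP; exists q; ring.
  - by right; left; apply/dvdzP; exists q; ring.
  - by do 2!right; left; apply/dvdzP; exists (q + 1); ring.
  - by do 3!right; left; apply/dvdzP; exists q; ring.
  - by do 4!right; apply/dvdzP; exists (q + 1); ring.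
case=> [|[|[|[|]]]] /res; rewrite ?mulr1z ?mulrN1z //.
by rewrite mulr0z subr0.
Qed.

End Residue.

Lemma squarefree_logn p m : prime p -> squarefree m -> (logn p m <= 1)%N.
Proof.
move=> pp sq; rewrite leqNgt; apply/negP => l2.
have m0 : (0 < m)%N by rewrite lt0n; apply: contraTneq l2 => ->; rewrite logn0.
have := sq p; rewrite pfactor_dvdn // => /(_ l2) p1.
by move: pp; rewrite p1.
Qed.

Lemma coprime_logn p x y : prime p -> (0 < x)%N -> (0 < y)%N -> coprime x y ->
  logn p x = 0%N \/ logn p y = 0%N.
Proof.
move=> pp x0 y0 cop.
case: (posnP (logn p x)) => [->|lx]; first by left.
case: (posnP (logn p y)) => [->|ly]; first by right.
have px : (p %| x)%N by rewrite -[p]expn1 pfactor_dvdn.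
have py : (p %| y)%N by rewrite -[p]expn1 pfactor_dvdn.
have : (p %| gcdn x y)%N by rewrite dvdn_gcd px.
by move: cop; rewrite /coprime => /eqP->; rewrite dvdn1 => /eqP p1; move: pp; rewrite p1.
Qed.

(** * The part of the resolvent's fifth power free of fifth powers *)

Section Theta.

Variables (zeta : algC) (n : int).
Hypothesis zeta_prim : 5.-primitive_root zeta.
Hypothesis n_not5 : ~~ (5 %| n)%Z.

Let z5 : zeta ^+ 5 = 1 := prim_expr_order zeta_prim.

Notation Z := (Zzeta zeta).
Notation dvd := (Zzeta_dvd zeta).
Notation Ak k := (A_ (zeta ^+ k) n).
Notation above p k pi := (common_prime_divisor zeta p (Ak k) pi).

Lemma B_A : B_ zeta n = Ak 3.
Proof. by rewrite /B_ /A_ -!exprM -(expr_mod 12 z5) -(expr_mod 6 z5). Qed.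

Lemma C_A : C_ zeta n = Ak 2.
Proof. by rewrite /C_ /A_ -!exprM -(expr_mod 8 z5). Qed.

(** [lam] divides N, and N = 1 modulo 5 because all its primes are; so [lam] is prime to 1 - zeta
    and [u_] does not take its default value. Divisibility of N by [al] will supply the cofactor of
    beta in the dual element. *)
Lemma alpha_factor N j m (ps : 'I_m -> nat) (pis : 'I_m -> algC) :
    (0 < j < 5)%N -> (0 < N)%N -> Delta_primes n N ->
    prime_element_choice zeta N (Ak j) ps pis ->
  let lam := \prod_i pis i in let al := u_ zeta lam * lam in
  [/\ Z al, dvd (1 - zeta) (al - 1), dvd al N%:R &
    forall p k pi, prime p -> (p %| lehmer_Delta n)%Z -> (0 < k < 5)%N ->
      above p k pi -> zval zeta pi al (if j == k then logn p N else 0%N)].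
Proof.
move=> j5 N0 hN ch lam al; have [NE ps_pr pisP] := ch.
have Zlam : Z lam by apply: Zzeta_prod => i; case: (pisP i) => -[].
have lamN : dvd lam N%:R.
  rewrite NE natr_prod /lam; elim/big_ind2: _ => [|x1 x2 y1 y2|i _].
  - exact: Zdvd_refl.
  - exact: Zdvd_mul.
  - by case: (pisP i).
have nlam : ~ dvd (1 - zeta) lam.
  move=> /Zdvd_trans/(_ lamN)/(@lambda_Zdvd_int _ zeta_prim (Posz N)).
  rewrite dvdzE /= /dvdn.
  by rewrite (Delta_primes_mod5 zeta_prim n_not5 N0 hN).
have [Zu u1 hu] := u_unit zeta_prim Zlam nlam.
split=> //; first exact: ZzetaM.
  by rewrite -[X in dvd _ X]mul1r; apply: Zdvd_mul.
move=> p k pi pp pD k5 ab; rewrite -[X in zval _ _ _ X]add0n.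
have [P _ _] := ab; apply: (zvalM P); first exact: zval_unit.
exact: (zval_choice zeta_prim n_not5 pp pD j5 k5 ab ch).
Qed.

Variables a b c d e : nat.
Hypothesis Delta_eq : lehmer_Delta n = (a * b ^ 2 * c ^ 3 * d ^ 4 * e ^ 5)%N%:Z.
Hypothesis abcde_gt0 : [&& 0 < a, 0 < b, 0 < c, 0 < d & 0 < e]%N.
Hypothesis abcd_sqfree :
  [/\ squarefree a, squarefree b, squarefree c & squarefree d].
Hypothesis abcd_coprime : pairwise coprime [:: a; b; c; d].

Lemma Delta_primes_bcde i j k l : Delta_primes n (b ^ i * c ^ j * d ^ k * e ^ l).
Proof.
have D m x q : (x ^ m.+1 * q)%N = `|lehmer_Delta n|%N -> Delta_primes n x.
  move=> E p pp px; rewrite dvdzE /= -E.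
  by apply: dvdn_mulr; apply: dvdn_exp.
rewrite Delta_eq absz_nat in D.
apply: Delta_primesM; [apply: Delta_primesM; [apply: Delta_primesM|]|];
  apply: Delta_primesX.
- by apply: (D 1%N _ (a * c ^ 3 * d ^ 4 * e ^ 5)%N); ring.
- by apply: (D 2%N _ (a * b ^ 2 * d ^ 4 * e ^ 5)%N); ring.
- by apply: (D 3%N _ (a * b ^ 2 * c ^ 3 * e ^ 5)%N); ring.
- by apply: (D 4%N _ (a * b ^ 2 * c ^ 3 * d ^ 4)%N); ring.
Qed.

Lemma bcde_gt0 i j k l : (0 < b ^ i * c ^ j * d ^ k * e ^ l)%N.
Proof.
by rewrite !muln_gt0 !expn_gt0; case/and5P: abcde_gt0 => _ -> -> -> ->.
Qed.

Lemma logn_bcde p i j k l : logn p (b ^ i * c ^ j * d ^ k * e ^ l)%N =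
  (i * logn p b + j * logn p c + k * logn p d + l * logn p e)%N.
Proof.
case/and5P: abcde_gt0 => _ b0 c0 d0 e0.
by rewrite !lognM ?lognX // ?muln_gt0 ?expn_gt0 ?b0 ?c0 ?d0 ?e0.
Qed.

Lemma logn_abcd p : prime p ->
  (logn p a + logn p b + logn p c + logn p d <= 1)%N.
Proof.
move=> pp; case/and5P: abcde_gt0 => a0 b0 c0 d0 _; case: abcd_sqfree => sa sb sc sd.
move: abcd_coprime => /= /and4P[/and4P[ab ac ad _] /and3P[bc bd _] /andP[cd _] _].
have := (squarefree_logn pp sa, squarefree_logn pp sb).
have := (squarefree_logn pp sc, squarefree_logn pp sd).
have := coprime_logn pp a0 b0 ab; have := coprime_logn pp a0 c0 ac.
have := coprime_logn pp a0 d0 ad; have := coprime_logn pp b0 c0 bc.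
have := coprime_logn pp b0 d0 bd; have := coprime_logn pp c0 d0 cd.
by move=> ? ? ? ? ? ? [? ?] [? ?]; lia.
Qed.

Let N1 := (b * c ^ 2 * d ^ 3 * e ^ 3)%N.
Let N2 := (b * c * d ^ 2 * e ^ 2)%N.
Let N3 := (c * d * e)%N.
Let M := (b * c ^ 2 * d ^ 3 * e ^ 4)%N.

Let N1E : N1 = (b ^ 1 * c ^ 2 * d ^ 3 * e ^ 3)%N. Proof. by rewrite expn1. Qed.
Let N2E : N2 = (b ^ 1 * c ^ 1 * d ^ 2 * e ^ 2)%N. Proof. by rewrite !expn1. Qed.
Let N3E : N3 = (b ^ 0 * c ^ 1 * d ^ 1 * e ^ 1)%N. Proof. by rewrite !expn1 mul1n. Qed.
Let ME : M = (b ^ 1 * c ^ 2 * d ^ 3 * e ^ 4)%N. Proof. by rewrite expn1. Qed.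

(* With l = logn p Delta and at most one of a, b, c, d divisible by p, the
   exponents 1, 2, 3, 4 of the four conjugates of A_n make the valuation of
   theta at the primes above p equal to l, 2l, 3l, 4l reduced modulo 5. *)
Lemma theta_exists (al1 al2 al3 : algC) :
    Z al1 -> Z al2 -> Z al3 ->
    (forall p k pi, prime p -> (p %| lehmer_Delta n)%Z -> (0 < k < 5)%N ->
      above p k pi -> zval zeta pi al1 (if 1%N == k then logn p N1 else 0%N)) ->
    (forall p k pi, prime p -> (p %| lehmer_Delta n)%Z -> (0 < k < 5)%N ->
      above p k pi -> zval zeta pi al2 (if 3%N == k then logn p N2 else 0%N)) ->
    (forall p k pi, prime p -> (p %| lehmer_Delta n)%Z -> (0 < k < 5)%N ->
      above p k pi -> zval zeta pi al3 (if 2%N == k then logn p N3 else 0%N)) ->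
  exists2 theta, Z theta /\
    (forall p k pi, prime p -> (p %| lehmer_Delta n)%Z -> (0 < k < 5)%N ->
      above p k pi -> exists2 v, (v < 5)%N & zval zeta pi theta v) &
    (al1 * al2 * al3) ^+ 5 * - (Ak 1 * Ak 3 ^+ 2 * Ak 2 ^+ 3 * Ak 4 ^+ 4) =
      M%:R ^+ 5 * theta.
Proof.
move=> Z1 Z2 Z3 v1 v2 v3.
pose R := (al1 * al2 * al3) ^+ 5 * - (Ak 1 * Ak 3 ^+ 2 * Ak 2 ^+ 3 * Ak 4 ^+ 4).
(* The lower bound lets M^5 divide R; the upper bound leaves the quotient theta with valuation below
   5. *)
have vR p k pi : prime p -> (p %| lehmer_Delta n)%Z -> (0 < k < 5)%N ->
    above p k pi -> exists2 r, zval zeta pi R r &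
      (5 * logn p M <= r < 5 * logn p M + 5)%N.
  move=> pp pD k5 ab; have [P _ _] := ab.
  have LD : logn p `|lehmer_Delta n| =
      (logn p a + 2 * logn p b + 3 * logn p c + 4 * logn p d + 5 * logn p e)%N.
    have -> : `|lehmer_Delta n|%N = (a * (b ^ 2 * c ^ 3 * d ^ 4 * e ^ 5))%N.
      by rewrite Delta_eq absz_nat !mulnA.
    rewrite lognM ?bcde_gt0 //; last by case/and5P: abcde_gt0.
    by rewrite logn_bcde; lia.
  have vA j : (0 < j < 5)%N ->
      zval zeta pi (Ak j) (if j == k then logn p `|lehmer_Delta n| else 0%N).
    move=> j5; case: eqP => [->|jk]; first exact: zval_above_A.
    exact: (zval_above_A0 zeta_prim n_not5 pp pD j5 k5 jk ab).
  have vN : zval zeta pi (-1) 0.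
    apply: (zval_unit P); first by apply: ZzetaN; apply: Zzeta1.
    by exists (-1); rewrite ?mulrNN ?mulr1 //; apply: ZzetaN; apply: Zzeta1.
  have RE : R = -1 * ((al1 * al2 * al3) ^+ 5
     * (Ak 1 * Ak 3 ^+ 2 * Ak 2 ^+ 3 * Ak 4 ^+ 4)) by rewrite /R; ring.
  have := zvalM P vN (zvalM P
     (zvalX P 5 (zvalM P (zvalM P (v1 _ _ _ pp pD k5 ab) (v2 _ _ _ pp pD k5 ab))
       (v3 _ _ _ pp pD k5 ab)))
     (zvalM P (zvalM P (zvalM P (vA 1%N isT) (zvalX P 2 (vA 3%N isT)))
        (zvalX P 3 (vA 2%N isT))) (zvalX P 4 (vA 4%N isT)))).
  rewrite -RE => vR; eexists; first exact: vR.
  rewrite ME N1E N2E N3E !logn_bcde LD; move: (logn_abcd pp) k5.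
  move: (logn p a) (logn p b) (logn p c) (logn p d) (logn p e); clear.
  by move=> la lb lc ld le; case: k => [|[|[|[|[|]]]]] //= h _; lia.
have ZR : Z R.
  have ZA j := ZAk zeta n j.
  by do ?[exact: ZA | exact: Z1 | exact: Z2 | exact: Z3 | apply: ZzetaN | apply: ZzetaX | apply: ZzetaM].
have M5 : Delta_primes n (M ^ 5).
  by apply: Delta_primesX; rewrite ME; apply: Delta_primes_bcde.
have M0 : (0 < M)%N by rewrite ME; apply: bcde_gt0.
have M50 : (0 < M ^ 5)%N by rewrite expn_gt0 M0.
have [theta Zt tE] : dvd (M ^ 5)%N%:R R.
  apply: (nat_Zdvd_above zeta_prim n_not5 M50 M5 ZR) => p k pi pp pM k5 ab.
  have [r vr /andP[le _]] := vR p k pi pp (M5 p pp pM) k5 ab.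
  by have [P _ _] := ab; apply: (dvd_zval P vr); rewrite lognX.
exists theta; last by rewrite -/R tE natrX.
split=> // p k pi pp pD k5 ab; have [r vr /andP[le lt]] := vR p k pi pp pD k5 ab.
have [P _ _] := ab; rewrite tE in vr.
have [_ vt] := zval_div P Zt vr (zval_above_nat zeta_prim n_not5 pp pD k5 ab M50).
exists (r - logn p (M ^ 5))%N => //; rewrite lognX ltn_subLR //.
Qed.

End Theta.

(** * The orbit of a root of Lehmer's quintic *)

Section Orbit.

Variables (K : fieldType) (s : {rmorphism K -> K}) (N x : K).
Hypothesis sN : s N = N.
Hypothesis x_root : x ^+ 5 = - N ^+ 2 * x ^+ 4
  + (2 * N ^+ 3 + 6 * N ^+ 2 + 10 * N + 10) * x ^+ 3
  - (N ^+ 4 + 5 * N ^+ 3 + 11 * N ^+ 2 + 15 * N + 5) * x ^+ 2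
  - (N ^+ 3 + 4 * N ^+ 2 + 10 * N + 10) * x - 1.
Hypothesis sx : s x = (N + 2 + N * x - x ^+ 2) / (1 + (N + 2) * x).

(** [dl ^+ 2] is the product of 1 + (N + 2) y over the roots y of the quintic, the norm of the
    denominator in [sx]; [dl] itself already clears the denominators of the conjugates. *)
Let dl : K := N ^+ 3 + 5 * N ^+ 2 + 10 * N + 7.
Hypothesis dl0 : dl != 0.

(* dl * s^j x as a polynomial in x of degree at most 4. *)
Let P1 : K :=
   (22 + 39 * N + 26 * N ^+ 2 + 8 * N ^+ 3 + N ^+ 4)
   + (36 + 107 * N + 131 * N ^+ 2 + 89 * N ^+ 3 + 37 * N ^+ 4 + 9 * N ^+ 5 + N ^+ 6) * x
   + (- 39 - 80 * N - 76 * N ^+ 2 - 43 * N ^+ 3 - 14 * N ^+ 4 - 2 * N ^+ 5) * x ^+ 2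
   + (- 2 - N + 4 * N ^+ 2 + 4 * N ^+ 3 + N ^+ 4) * x ^+ 3
   + (4 + 4 * N + N ^+ 2) * x ^+ 4.
Let P2 : K :=
   (- 6 - 7 * N - 2 * N ^+ 2)
   + (- 6 - 29 * N - 36 * N ^+ 2 - 21 * N ^+ 3 - 7 * N ^+ 4 - N ^+ 5) * x
   + (24 + 41 * N + 31 * N ^+ 2 + 14 * N ^+ 3 + 3 * N ^+ 4) * x ^+ 2
   + (- 2 - 3 * N - 4 * N ^+ 2 - 2 * N ^+ 3) * x ^+ 3
   + (- 3 - 2 * N) * x ^+ 4.
Let P3 : K :=
   (- 25 - 52 * N - 47 * N ^+ 2 - 24 * N ^+ 3 - 7 * N ^+ 4 - N ^+ 5)
   + (- 18 - 59 * N - 81 * N ^+ 2 - 62 * N ^+ 3 - 29 * N ^+ 4 - 8 * N ^+ 5 - N ^+ 6) * x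
   + (23 + 53 * N + 54 * N ^+ 2 + 33 * N ^+ 3 + 12 * N ^+ 4 + 2 * N ^+ 5) * x ^+ 2
   + (1 + N - 2 * N ^+ 2 - 3 * N ^+ 3 - N ^+ 4) * x ^+ 3
   + (- 2 - 3 * N - N ^+ 2) * x ^+ 4.
Let P4 : K :=
   (9 + 20 * N + 16 * N ^+ 2 + 6 * N ^+ 3 + N ^+ 4)
   + (- 19 - 29 * N - 19 * N ^+ 2 - 7 * N ^+ 3 - N ^+ 4) * x
   + (- 8 - 14 * N - 9 * N ^+ 2 - 4 * N ^+ 3 - N ^+ 4) * x ^+ 2
   + (3 + 3 * N + 2 * N ^+ 2 + N ^+ 3) * x ^+ 3
   + (1 + N) * x ^+ 4.

(* A vanishing denominator would give s x = 0, by the convention on division. *)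
Lemma orbit_den j : 1 + (N + 2) * iter j s x != 0.
Proof.
elim: j => [|j IH] /=.
  apply/eqP => d0; move: sx; rewrite d0 invr0 mulr0 => /eqP; rewrite fmorph_eq0.
  move=> /eqP x0; move: x_root; rewrite x0 => /eqP.
  rewrite -subr_eq0 (_ : _ - _ = 1); last by ring.
  by rewrite oner_eq0.
have -> : 1 + (N + 2) * s (iter j s x) = s (1 + (N + 2) * iter j s x).
  by rewrite rmorphD rmorphM rmorphD rmorph1 rmorph_nat sN.
by rewrite fmorph_eq0.
Qed.

Lemma orbit_step j : iter j.+1 s x * (1 + (N + 2) * iter j s x) =
  N + 2 + N * iter j s x - iter j s x ^+ 2.
Proof.
elim: j => [|j IH] /=; first by rewrite sx divfK //; have := orbit_den 0.
transitivity (s (iter j.+1 s x * (1 + (N + 2) * iter j s x))).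
  by rewrite /=; ring: sN.
by rewrite IH; ring: sN.
Qed.

(** The recursion with denominators cleared: each conjugate is certified by one polynomial identity
    modulo the quintic. *)
Lemma orbit_next j (P Q : K) : iter j s x = P / dl ->
    Q * (dl + (N + 2) * P) = (N + 2) * dl ^+ 2 + N * P * dl - P ^+ 2 ->
  iter j.+1 s x = Q / dl.
Proof.
move=> jE PQ; apply: (mulIf (orbit_den j)); rewrite orbit_step jE.
apply: (mulIf dl0); apply: (mulIf dl0).
have -> : Q / dl * (1 + (N + 2) * (P / dl)) * dl * dl =
    Q * (dl + (N + 2) * P) by field.
by rewrite PQ; field.
Qed.

Let orbit0 : iter 0 s x = x * dl / dl. Proof. by rewrite mulfK. Qed.

Let orbit1 : iter 1 s x = P1 / dl.
Proof. by apply: (orbit_next orbit0); rewrite /P1 /dl; ring: x_root. Qed.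

Let orbit2 : iter 2 s x = P2 / dl.
Proof. by apply: (orbit_next orbit1); rewrite /P1 /P2 /dl; ring: x_root. Qed.

Let orbit3 : iter 3 s x = P3 / dl.
Proof. by apply: (orbit_next orbit2); rewrite /P2 /P3 /dl; ring: x_root. Qed.

Let orbit4 : iter 4 s x = P4 / dl.
Proof. by apply: (orbit_next orbit3); rewrite /P3 /P4 /dl; ring: x_root. Qed.

Lemma orbit5 : iter 5 s x = x.
Proof.
rewrite -[RHS](mulfK dl0).
by apply: (orbit_next orbit4); rewrite /P4 /dl; ring: x_root.
Qed.

Lemma orbit_sum : x + iter 1 s x + iter 2 s x + iter 3 s x + iter 4 s x = - N ^+ 2.
Proof.
rewrite orbit1 orbit2 orbit3 orbit4; apply: (mulIf dl0).
have -> : (x + P1 / dl + P2 / dl + P3 / dl + P4 / dl) * dl =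
    x * dl + P1 + P2 + P3 + P4 by field.
by rewrite /P1 /P2 /P3 /P4 /dl; ring.
Qed.

Lemma orbit_mul1 :
  x * iter 1 s x = - (1 + N + N ^+ 2) + N * x - iter 1 s x - iter 3 s x.
Proof.
rewrite orbit1 orbit3; apply: (mulIf dl0).
have -> : x * (P1 / dl) * dl = x * P1 by field.
have -> : (- (1 + N + N ^+ 2) + N * x - P1 / dl - P3 / dl) * dl =
   (- (1 + N + N ^+ 2) + N * x) * dl - P1 - P3 by field.
by rewrite /P1 /P3 /dl; ring: x_root.
Qed.

Lemma orbit_mul2 :
  x * iter 2 s x = - (1 + N) + iter 1 s x + (N + 2) * iter 2 s x.
Proof.
rewrite orbit1 orbit2; apply: (mulIf dl0).
have -> : x * (P2 / dl) * dl = x * P2 by field.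
have -> : (- (1 + N) + P1 / dl + (N + 2) * (P2 / dl)) * dl =
   - (1 + N) * dl + P1 + (N + 2) * P2 by field.
by rewrite /P1 /P2 /dl; ring: x_root.
Qed.

Lemma orbit_mul1_iter i : iter i s x * iter i.+1 s x =
  - (1 + N + N ^+ 2) + N * iter i s x - iter i.+1 s x - iter (i + 3) s x.
Proof.
elim: i => [|i IH]; first exact: orbit_mul1.
transitivity (s (iter i s x * iter i.+1 s x)); first by rewrite rmorphM.
by rewrite IH /=; ring: sN.
Qed.

Lemma orbit_mul2_iter i : iter i s x * iter i.+2 s x =
  - (1 + N) + iter i.+1 s x + (N + 2) * iter i.+2 s x.
Proof.
elim: i => [|i IH]; first exact: orbit_mul2.
transitivity (s (iter i s x * iter i.+2 s x)); first by rewrite rmorphM.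
by rewrite IH /=; ring: sN.
Qed.

End Orbit.

(** * An embedding of the field into the algebraic numbers *)

Section Embedding.

Variables (L : fieldExtType rat) (rho : L).
Hypothesis L_gen : <<1; rho>>%VS = {:L}%VS.

Let ev (p : {poly rat}) : L := (map_poly (in_alg L) p).[rho].

Let evP y : exists p, ev p = y.
Proof.
have : y \in <<1; rho>>%VS by rewrite L_gen memvf.
move=> /Fadjoin_polyP[q /polyOver1P[p ->] ->].
by exists p.
Qed.

(** Send rho to any root of its minimal polynomial. [pr] chooses a rational polynomial representing
    each element, and [h_eq] makes the value at that root independent of the choice. *)
Lemma exists_embedding : inhabited {rmorphism L -> algC}.
Proof.
have [q qE] : exists q : {poly rat}, map_poly (in_alg L) q = minPoly 1 rho.
  by have /polyOver1P[q] := minPolyOver 1 rho; exists q.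
have [r r0] : exists r : algC, root (map_poly ratr q) r.
  apply/closed_rootP; rewrite size_map_poly -(size_map_poly (in_alg L)) qE.
  by rewrite size_minPoly gtn_eqF // ltnS.
pose h (p : {poly rat}) : algC := (map_poly ratr p).[r].
have h_eq p p' : ev p = ev p' -> h p = h p'.
  move=> E; have : root (map_poly (in_alg L) (p - p')) rho.
    by rewrite rootE rmorphB hornerD hornerN -/(ev p) -/(ev p') E subrr.
  move=> /(minPoly_dvdp (alg_polyOver 1 _)); rewrite -qE dvdp_map => /dvdpP[t tE].
  apply/eqP; rewrite -subr_eq0 /h -hornerN -hornerD -rmorphB tE rmorphM hornerM.
  by rewrite (rootP r0) mulr0.
have /choice[pr prP] := evP.
pose iota y := h (pr y).
have iotaE p : iota (ev p) = h p by apply: h_eq; rewrite prP.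
have iotaB : zmod_morphism iota.
  move=> y z; rewrite -(prP y) -(prP z) -[_ - _]/(ev _ - ev _).
  have -> : ev (pr y) - ev (pr z) = ev (pr y - pr z).
    by rewrite /ev rmorphB hornerD hornerN.
  by rewrite !iotaE /h rmorphB hornerD hornerN.
have iotaM : monoid_morphism iota.
  split.
    have -> : 1 = ev 1 by rewrite /ev rmorph1 hornerC.
    by rewrite iotaE /h rmorph1 hornerC.
  move=> y z; rewrite -(prP y) -(prP z).
  have -> : ev (pr y) * ev (pr z) = ev (pr y * pr z).
    by rewrite /ev rmorphM hornerM.
  by rewrite !iotaE /h rmorphM hornerM.
pose iB := GRing.isZmodMorphism.Build _ _ iota iotaB.
pose iM := GRing.isMonoidMorphism.Build _ _ iota iotaM.
exact: (inhabits (HB.pack_for {rmorphism L -> algC} iota iB iM)).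
Qed.

End Embedding.

(** * Resolvents *)

Section Gauss.

Variables (R : comNzRingType) (N w : R) (r : nat -> R).
Hypothesis r5 : forall i, r (i + 5)%N = r i.
Hypothesis r_sum : r 0%N + r 1%N + r 2%N + r 3%N + r 4%N = - N ^+ 2.
Hypothesis r_step : forall i,
  r i.+1 * (1 + (N + 2) * r i) = N + 2 + N * r i - r i ^+ 2.
Hypothesis r_mul1 : forall i,
  r i * r i.+1 = - (1 + N + N ^+ 2) + N * r i - r i.+1 - r (i + 3)%N.
Hypothesis r_mul2 : forall i,
  r i * r i.+2 = - (1 + N) + r i.+1 + (N + 2) * r i.+2.
Hypothesis w4 : w ^+ 4 = - 1 - w - w ^+ 2 - w ^+ 3.

(** The Lagrange resolvent with weights z^j. The one with weights zeta^(-j) is its value at zeta^4,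
    whence the exponent 4 in what follows. *)
Definition gauss (z : R) : R :=
  r 0%N + r 1%N * z + r 2%N * z ^+ 2 + r 3%N * z ^+ 3 + r 4%N * z ^+ 4.

Let A (z : R) : R := N + 2 + 2 * z ^+ 4 + z ^+ 2.

Let r4E : r 4%N = - N ^+ 2 - r 0%N - r 1%N - r 2%N - r 3%N.
Proof. by rewrite -r_sum; ring. Qed.

Lemma r_sq i : r i ^+ 2 = 4 + 4 * N + 3 * N ^+ 2 + N ^+ 3 - (N + N ^+ 2) * r i
   + (1 + N) * r i.+1 + (N + 2) * r (i + 3)%N.
Proof.
transitivity (N + 2 + N * r i - r i.+1 - (N + 2) * (r i * r i.+1)).
  by have -> : N + 2 + N * r i - r i.+1 - (N + 2) * (r i * r i.+1) =
    (N + 2 + N * r i - r i ^+ 2) - r i.+1 * (1 + (N + 2) * r i) + r i ^+ 2;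
    [ring | rewrite r_step subrr add0r].
by rewrite r_mul1; ring.
Qed.

(* The analogues of |tau|^2 = p and of the Jacobi sum tau(chi)^2 / tau(chi^2)
   for Gauss sums. *)
Lemma gauss_prod : gauss w * gauss (w ^+ 4) =
  N ^+ 4 + 5 * N ^+ 3 + 15 * N ^+ 2 + 25 * N + 25
  /\ gauss (w ^+ 4) ^+ 2 = - A (w ^+ 2) * A (w ^+ 4) * gauss (w ^+ 3).
Proof.
have e01 := r_mul1 0; have e12 := r_mul1 1; have e23 := r_mul1 2.
have e02 := r_mul2 0; have e13 := r_mul2 1.
have e30 : r 0%N * r 3%N = - (1 + N) + r 4%N + (N + 2) * r 0%N.
  by rewrite mulrC -(r5 0) (r_mul2 3).
have s0 := r_sq 0; have s1 := r_sq 1; have s2 := r_sq 2; have s3 := r_sq 3.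
rewrite /= ?(r5 0) ?(r5 1) !r4E in e01 e12 e23 e02 e13 e30 s0 s1 s2 s3.
rewrite /gauss /A !r4E.
move: e01 e12 e23 e02 e13 e30 s0 s1 s2 s3.
rewrite ![(_ + 3)%N]/= ?(r5 0) ?(r5 1).
move: (r 0%N) (r 1%N) (r 2%N) (r 3%N) => r0 r1 r2 r3.
move=> e01 e12 e23 e02 e13 e30 s0 s1 s2 s3.
split.
  by ring: e01 e12 e23 e02 e13 e30 s0 s1 s2 s3 w4.
by ring: e01 e12 e23 e02 e13 e30 s0 s1 s2 s3 w4.
Qed.

End Gauss.

Lemma Aint_root5 (x : algC) : x ^+ 5 \in Aint -> x \in Aint.
Proof.
move=> Ax; apply: (@root_monic_Aint (minCpoly (x ^+ 5) \Po 'X^5)).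
- by rewrite rootE horner_comp hornerXn -rootE root_minCpoly.
- by rewrite monicE lead_coef_comp ?size_polyXn // lead_coefXn expr1n mulr1
    -monicE minCpoly_monic.
by rewrite polyOver_comp ?rpredX ?polyOverX.
Qed.

Lemma iota_integral (L : fieldExtType rat) (iota : {rmorphism L -> algC}) (y : L) :
  integralOver (intr : int -> L) y <-> iota y \in Aint.
Proof.
split=> [[p mp py]|].
  apply: (@root_monic_Aint (map_poly intr p)).
  - have := fmorph_root iota (map_poly intr p) y.
    rewrite py -map_poly_comp => h.
    by rewrite (eq_map_poly (g := iota \o intr)) // => t /=; rewrite rmorph_int.
  - exact: monic_map.
  - by apply/polyOverP => i; rewrite coef_map /= intr_int.
move=> /floorpP[p pE]; exists p.
  have := minCpoly_monic (iota y); rewrite pE !monicE.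
  rewrite (lead_coef_map_inj (@intr_inj algC) (erefl _)) /= => /eqP h.
  by apply/eqP; apply: (@intr_inj algC); rewrite h.
rewrite -(fmorph_root iota) -map_poly_comp.
rewrite (eq_map_poly (g := intr)) => [|t /=]; last by rewrite rmorph_int.
by rewrite -pE root_minCpoly.
Qed.

(** Let t_k be the resolvent at w^k and A_k the conjugate of A_n at w^k. The Jacobi relation at w
    and at w^2 reads t_4^2 = -A_2 A_4 t_3 and t_3^2 = -A_4 A_3 t_1. So t_4^5 = t_4 (A_2 A_4 t_3)^2 =
    -(t_1 t_4) A_2^2 A_3 A_4^3, and t_1 t_4 = Delta_n = A_1 A_2 A_3 A_4. As in Stickelberger's
    theorem, the exponent of A_k is the inverse of k modulo 5. *)
Lemma gauss_pow5 (n : int) (w : algC) (r : nat -> algC) :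
    5.-primitive_root w ->
    (forall i, r (i + 5)%N = r i) ->
    r 0%N + r 1%N + r 2%N + r 3%N + r 4%N = - n%:~R ^+ 2 ->
    (forall i, r i.+1 * (1 + (n%:~R + 2) * r i) =
       n%:~R + 2 + n%:~R * r i - r i ^+ 2) ->
    (forall i, r i * r i.+1 =
       - (1 + n%:~R + n%:~R ^+ 2) + n%:~R * r i - r i.+1 - r (i + 3)%N) ->
    (forall i, r i * r i.+2 = - (1 + n%:~R) + r i.+1 + (n%:~R + 2) * r i.+2) ->
  gauss r w * gauss r (w ^+ 4) = (lehmer_Delta n)%:~R /\
  gauss r (w ^+ 4) ^+ 5 = - (A_ w n * A_ (w ^+ 3) n ^+ 2
    * A_ (w ^+ 2) n ^+ 3 * A_ (w ^+ 4) n ^+ 4).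
Proof.
move=> wP r5 rs rst rm1 rm2; have w5 := prim_expr_order wP.
have [g14 g4] := gauss_prod r5 rs rst rm1 rm2 (prim5_exp4 wP).
have w2P := zeta_prim_exp wP (isT : (0 < 2 < 5)%N).
have [_ g3] := gauss_prod r5 rs rst rm1 rm2 (prim5_exp4 w2P).
have DE : (lehmer_Delta n)%:~R = n%:~R ^+ 4 + 5 * n%:~R ^+ 3 + 15 * n%:~R ^+ 2
    + 25 * n%:~R + 25 :> algC by rewrite /lehmer_Delta; ring.
rewrite DE g14; split=> //.
have AE := prod_Ak n wP (isT : (0 < 1 < 5)%N).
have {}g4 : gauss r (w ^+ 4) ^+ 2 =
  - A_ (w ^+ 2) n * A_ (w ^+ 4) n * gauss r (w ^+ 3) := g4.
have e4 : w ^+ 2 ^+ 2 = w ^+ 4 by rewrite -exprM.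
have e8 : w ^+ 2 ^+ 4 = w ^+ 3 by rewrite -exprM -(expr_mod 8 w5).
have e6 : w ^+ 2 ^+ 3 = w by rewrite -exprM -(expr_mod 6 w5).
have {}g3 : gauss r (w ^+ 2 ^+ 4) ^+ 2 = - A_ (w ^+ 2 ^+ 2) n
  * A_ (w ^+ 2 ^+ 4) n * gauss r (w ^+ 2 ^+ 3) := g3.
rewrite e8 e6 e4 in g3.
transitivity (gauss r (w ^+ 4) * (gauss r (w ^+ 4) ^+ 2) ^+ 2); first by ring.
rewrite g4; transitivity (gauss r (w ^+ 4) * (A_ (w ^+ 2) n * A_ (w ^+ 4) n) ^+ 2
  * gauss r (w ^+ 3) ^+ 2); first by ring.
rewrite g3; transitivity ((gauss r w * gauss r (w ^+ 4))
  * - (A_ (w ^+ 2) n ^+ 2 * A_ (w ^+ 4) n ^+ 3 * A_ (w ^+ 3) n)); first by ring.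
rewrite g14 -DE -AE !expr1; ring.
Qed.

Section Resolvent.

Variables (L : fieldExtType rat) (s : {rmorphism L -> L}).
Variable iota : {rmorphism L -> algC}.
Hypothesis s5 : forall y, iter 5 s y = y.
Hypothesis s_fixed : forall y, s y = y -> exists q : rat, y = ratr q.

Definition resolvent (z : algC) (y : L) : algC := gauss (fun i => iota (iter i s y)) z.

Lemma iter_add y y' j : iter j s (y + y') = iter j s y + iter j s y'.
Proof. by elim: j => //= j ->; rewrite rmorphD. Qed.

Lemma iter_mul y y' j : iter j s (y * y') = iter j s y * iter j s y'.
Proof. by elim: j => //= j ->; rewrite rmorphM. Qed.

Lemma iter_rat q j : iter j s (ratr q) = ratr q.
Proof. by elim: j => //= j ->; rewrite fmorph_rat. Qed.

Lemma tauD z y y' : resolvent z (y + y') = resolvent z y + resolvent z y'.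
Proof. by rewrite /resolvent /gauss !iter_add !rmorphD; ring. Qed.

Lemma tauZ z q y : resolvent z (ratr q * y) = ratr q * resolvent z y.
Proof.
have sq j := iter_rat q j; rewrite -[in RHS](fmorph_rat iota).
move: (ratr q : L) sq => c sc.
by rewrite /resolvent /gauss !iter_mul !sc !rmorphM; ring.
Qed.

Lemma tau_rat z q : 1 + z + z ^+ 2 + z ^+ 3 + z ^+ 4 = 0 -> resolvent z (ratr q) = 0.
Proof.
move=> z0; rewrite /resolvent /gauss !iter_rat fmorph_rat.
transitivity (ratr q * (1 + z + z ^+ 2 + z ^+ 3 + z ^+ 4)); first by ring.
by rewrite z0 mulr0.
Qed.

Lemma tau1_rat q : resolvent 1 (ratr q) = 5 * ratr q.
Proof. by rewrite /resolvent /gauss !iter_rat fmorph_rat; ring. Qed.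

Lemma tau_iter z y j : z ^+ 5 = 1 -> resolvent z (iter j s y) = (z ^+ 4) ^+ j * resolvent z y.
Proof.
move=> z5; elim: j => [|j IH]; first by rewrite mul1r.
rewrite exprS -mulrA -IH /resolvent /gauss -!iterSr.
by rewrite (_ : iter 5 s _ = iter j s y) ?s5 //=; ring: z5.
Qed.

Lemma tau_sum z (q : nat -> rat) y : z ^+ 5 = 1 ->
  resolvent z (\sum_(j < 5) ratr (q j) * iter j s y)
    = (\sum_(j < 5) ratr (q j) * (z ^+ 4) ^+ j) * resolvent z y.
Proof.
move=> z5; rewrite !big_ord_recl !big_ord0 !addr0.
by rewrite !tauD !tauZ !tau_iter //; ring.
Qed.

(** [resolvent 1] is the trace: a product of resolvents at inverse arguments is the Fourier
    transform of the trace pairing of x with the conjugates of y. *)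
Lemma tau_mul z x y : z ^+ 5 = 1 ->
  resolvent z x * resolvent (z ^+ 4) y =
    \sum_(j < 5) resolvent 1 (x * iter j s y) * (z ^+ 4) ^+ j.
Proof.
move=> z5; rewrite !big_ord_recl big_ord0 /resolvent /gauss !iter_mul /= /bump /=.
have E := s5 y; rewrite /= in E.
rewrite !E !rmorphM.
by ring: z5.
Qed.

Lemma Aint_s y : iota y \in Aint -> iota (s y) \in Aint.
Proof.
move=> /iota_integral [p mp pz]; apply/iota_integral; exists p => //.
have := fmorph_root s (map_poly intr p) y; rewrite pz -map_poly_comp => h.
by rewrite (eq_map_poly (g := s \o intr)) // => t /=; rewrite rmorph_int.
Qed.

Lemma Aint_iter y j : iota y \in Aint -> iota (iter j s y) \in Aint.
Proof. by move=> Ay; elim: j => //= j; apply: Aint_s. Qed.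

Lemma tau1_int y : iota y \in Aint -> exists m : int, resolvent 1 y = m%:~R.
Proof.
move=> Ay; pose t := y + iter 1 s y + iter 2 s y + iter 3 s y + iter 4 s y.
have tE : resolvent 1 y = iota t by rewrite /resolvent /gauss /t !rmorphD /=; ring.
have [q qE] : exists q : rat, t = ratr q.
  apply: s_fixed; rewrite /t !rmorphD -!iterS s5 /=; ring.
have Ai j := Aint_iter j Ay.
have : resolvent 1 y \in Num.int.
  apply: Cint_rat_Aint; first by rewrite tE qE fmorph_rat Crat_rat.
  by rewrite tE /t !rmorphD !rpredD.
by case/intrP=> m ->; exists m.
Qed.

Lemma tau_inversion zeta y : 5.-primitive_root zeta ->
  5 * iota y = resolvent 1 y + resolvent zeta y + resolvent (zeta ^+ 2) y + resolvent (zeta ^+ 3) y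
    + resolvent (zeta ^+ 4) y.
Proof.
by move=> zP; have z4 := prim5_exp4 zP; rewrite /resolvent /gauss /=; ring: z4.
Qed.

Lemma tau_inj zeta y y' : 5.-primitive_root zeta -> resolvent 1 y = resolvent 1 y' ->
  (forall k, (0 < k < 5)%N -> resolvent (zeta ^+ k) y = resolvent (zeta ^+ k) y') -> y = y'.
Proof.
move=> zP E1 Ek; apply: (fmorph_inj iota).
have n5 : 5 != 0 :> algC by rewrite pnatr_eq0.
apply: (mulfI n5); rewrite !(tau_inversion _ zP) E1 (Ek 2%N) // (Ek 3%N) // (Ek 4%N) //.
by have := Ek 1%N isT; rewrite expr1 => ->.
Qed.

End Resolvent.

(** * The normal integral basis *)

Section Basis.

Variables (zeta : algC) (n : int).
Hypothesis zeta_prim : 5.-primitive_root zeta.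
Hypothesis n_not5 : ~~ (5 %| n)%Z.
Variables (L : fieldExtType rat) (s : {rmorphism L -> L}).
Variable iota : {rmorphism L -> algC}.
Hypothesis s5 : forall y, iter 5 s y = y.
Hypothesis s_fixed : forall y, s y = y -> exists q : rat, y = ratr q.

Notation Z := (Zzeta zeta).
Notation dvd := (Zzeta_dvd zeta).
Notation Ak k := (A_ (zeta ^+ k) n).
Notation above p k pi := (common_prime_divisor zeta p (Ak k) pi).
Notation tau := (resolvent s iota).

Let z5 : zeta ^+ 5 = 1 := prim_expr_order zeta_prim.

Lemma tauZi z (c : int) y : tau z (c%:~R * y) = c%:~R * tau z y.
Proof. by have := tauZ s iota z c%:~R y; rewrite !ratr_int. Qed.

Lemma tau_int z (c : int) : 5.-primitive_root z -> tau z c%:~R = 0.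
Proof.
move=> zP; have := tau_rat s iota c%:~R (z := z); rewrite ratr_int; apply.
by rewrite (prim5_exp4 zP); ring.
Qed.

Lemma tau1_intr (c : int) : tau 1 c%:~R = 5 * c%:~R.
Proof. by have := tau1_rat s iota c%:~R; rewrite !ratr_int. Qed.

Variable rho : L.
Hypothesis tau_prod : forall w, 5.-primitive_root w ->
  tau w rho * tau (w ^+ 4) rho = (lehmer_Delta n)%:~R.
Hypothesis tau_pow : forall w, 5.-primitive_root w ->
  tau (w ^+ 4) rho ^+ 5 = - (A_ w n * A_ (w ^+ 3) n ^+ 2
    * A_ (w ^+ 2) n ^+ 3 * A_ (w ^+ 4) n ^+ 4).
Hypothesis tau_one : tau 1 rho = - n%:~R ^+ 2.
Hypothesis Arho : iota rho \in Aint.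

Variables (b0 b1 b2 b3 b0' b1' b2' b3' : int) (M N : nat) (theta : algC).
Variables (eps m : int) (alpha : L).
Let beta w := zlin w b0%:~R b1%:~R b2%:~R b3%:~R.
Let beta' w := zlin w b0'%:~R b1'%:~R b2'%:~R b3'%:~R.
Hypothesis beta_mod : dvd (1 - zeta) (beta zeta - 1).
Hypothesis bb' : beta zeta * beta' zeta = N%:R.
Hypothesis M_gt0 : (0 < M)%N.
Hypothesis M_primes : Delta_primes n M.
Hypothesis N_gt0 : (0 < N)%N.
Hypothesis N_primes : Delta_primes n N.
Hypothesis Ztheta : Z theta.
Hypothesis theta_free : forall p k pi, prime p -> (p %| lehmer_Delta n)%Z ->
  (0 < k < 5)%N -> above p k pi -> exists2 e, (e < 5)%N & zval zeta pi theta e.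
Hypothesis thetaE : beta zeta ^+ 5 * - (Ak 1 * Ak 3 ^+ 2 * Ak 2 ^+ 3 * Ak 4 ^+ 4) =
  M%:R ^+ 5 * theta.
Hypothesis eps2 : eps * eps = 1.
Hypothesis eps_mod : (5 %| eps - n ^+ 2)%Z.
Hypothesis mE : 5 * m = eps * M - n ^+ 2 * (b0 + b1 + b2 + b3).
Hypothesis alphaE : M%:R * alpha = b0%:~R * rho + b1%:~R * iter 1 s rho
  + b2%:~R * iter 2 s rho + b3%:~R * iter 3 s rho - m%:~R.

Let M0 : M%:R != 0 :> algC. Proof. by rewrite pnatr_eq0 -lt0n. Qed.

Let Delta_gt0 : lehmer_Delta n != 0.
Proof. by apply/eqP => D0; have := Delta_mod5 n_not5; rewrite D0. Qed.

Lemma tau_alpha w : 5.-primitive_root w ->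
  M%:R * tau (w ^+ 4) alpha = beta w * tau (w ^+ 4) rho.
Proof.
move=> wP; have w5 := prim_expr_order wP.
have w4P := zeta_prim_exp wP (isT : (0 < 4 < 5)%N).
have w45 := prim_expr_order w4P.
have w16 : w ^+ 4 ^+ 4 = w by rewrite -exprM -(expr_mod 16 w5).
rewrite -[M%:R]/((M%:Z)%:~R) -tauZi alphaE.
have -> : - m%:~R = (- m)%:~R :> L by rewrite rmorphN.
rewrite !tauD !tauZi !tau_iter // tau_int // w16 /beta /zlin; ring.
Qed.

(** This is what m is made for: rho has trace -n^2, and subtracting m turns the trace of M alpha
    into -eps M. *)
Lemma tau1_alpha : tau 1 alpha = - eps%:~R.
Proof.
apply: (mulfI M0); rewrite -[M%:R]/((M%:Z)%:~R) -tauZi alphaE.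
have -> : - m%:~R = (- m)%:~R :> L by rewrite rmorphN.
rewrite !tauD !tauZi !tau_iter ?expr1n // tau1_intr tau_one ?expr1n ?mul1r.
have := congr1 (fun t : int => t%:~R : algC) mE => mE'.
have -> : 5 * (- m)%:~R = - ((5 * m)%:~R) :> algC by rewrite rmorphM rmorphN /=; ring.
by rewrite mE'; ring.
Qed.

Lemma tau_alpha_pow (nu : {rmorphism algC -> algC}) k : (0 < k < 5)%N ->
  nu zeta = zeta ^+ k -> tau (zeta ^+ k ^+ 4) alpha ^+ 5 = nu theta.
Proof.
move=> k5 nuE; have wP := zeta_prim_exp zeta_prim k5.
have M50 : M%:R ^+ 5 != 0 :> algC by rewrite expf_neq0.
apply: (mulfI M50); rewrite -exprMn tau_alpha // exprMn tau_pow //.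
have <- : nu (M%:R ^+ 5 * theta) = M%:R ^+ 5 * nu theta.
  by rewrite rmorphM rmorphXn rmorph_nat.
rewrite -thetaE; have betaE : nu (beta zeta) = beta (zeta ^+ k).
  by rewrite /beta zlin_aut nuE !rmorph_int.
have AE j : nu (Ak j) = A_ (zeta ^+ k ^+ j) n by rewrite A_aut rmorphXn /= nuE exprAC.
have A1 : nu (Ak 1) = A_ (zeta ^+ k) n by rewrite AE expr1.
by rewrite -betaE -A1 -(AE 2%N) -(AE 3%N) -(AE 4%N); ring.
Qed.

Lemma Aint_tau_alpha k : (0 < k < 5)%N -> tau (zeta ^+ k ^+ 4) alpha \in Aint.
Proof.
move=> k5; have [nu nuE] := zeta_aut zeta_prim k5.
apply: Aint_root5; rewrite (tau_alpha_pow k5 nuE) Aint_aut.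
exact: Zzeta_Aint Ztheta.
Qed.

Lemma pow4K k : zeta ^+ k ^+ 4 ^+ 4 = zeta ^+ k.
Proof.
have w5 : zeta ^+ k ^+ 5 = 1 by rewrite exprAC z5 expr1n.
by rewrite -exprM -(expr_mod 16 w5).
Qed.

Lemma Aint_alpha : iota alpha \in Aint.
Proof.
have A5 : 5 * iota alpha \in Aint.
  rewrite (tau_inversion s iota alpha zeta_prim) tau1_alpha.
  have h k : (0 < k < 5)%N -> tau (zeta ^+ k) alpha \in Aint.
    move=> k5; have -> : zeta ^+ k = zeta ^+ (5 - k) ^+ 4.
      by move: k k5 => [|[|[|[|[|]]]]] // _; rewrite -exprM -[RHS](expr_mod _ z5).
    by apply: Aint_tau_alpha; move: k k5 => [|[|[|[|[|]]]]].
  have := h 1%N isT; rewrite expr1 => h1.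
  do 4![apply: rpredD; last by [exact: h1 | exact: h]].
  by rewrite rpredN Aint_int.
have AM : M%:R * iota alpha \in Aint.
  rewrite -(rmorph_nat iota) -rmorphM alphaE !rmorphB !rmorphD !rmorphM !rmorph_int.
  by rewrite !(rpredB, rpredD) // ?rpredM ?Aint_int //; apply: Aint_iter.
have : coprimez M 5.
  rewrite /coprimez /gcdz /= eqz_nat -/(coprime M 5) coprime_sym prime_coprime //.
  by rewrite /dvdn (Delta_primes_mod5 zeta_prim n_not5 M_gt0 M_primes).
case/bezout_int=> u [v /(congr1 (fun t : int => t%:~R : algC))].
rewrite rmorphD !rmorphM /= mulr1z => uv.
have -> : iota alpha = u%:~R * (M%:R * iota alpha) + v%:~R * (5 * iota alpha).
  by rewrite !mulrA -mulrDl uv mul1r.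
by apply: rpredD; apply: rpredM => //; apply: Aint_int.
Qed.

Let K : int := N%:Z * lehmer_Delta n.

Let K0 : K != 0. Proof. by rewrite mulf_neq0 // -lt0n. Qed.
Let KC : K%:~R != 0 :> algC. Proof. by rewrite intr_eq0. Qed.

Lemma beta_sum_mod5 (c0 c1 c2 c3 : int) (x : int) :
  dvd (1 - zeta) (zlin zeta c0%:~R c1%:~R c2%:~R c3%:~R - x%:~R) ->
  (5 %| c0 + c1 + c2 + c3 - x)%Z.
Proof.
move=> h; apply: (lambda_Zdvd_int zeta_prim).
have -> : (c0 + c1 + c2 + c3 - x)%:~R =
  (zlin zeta c0%:~R c1%:~R c2%:~R c3%:~R - x%:~R) -
  (zlin zeta c0%:~R c1%:~R c2%:~R c3%:~R - (c0 + c1 + c2 + c3)%:~R) :> algC by ring.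
by apply: Zdvd_sub => //; apply: lambda_residue.
Qed.

Let mod5_nat (k : nat) : (0 < k)%N -> Delta_primes n k -> (5 %| k%:Z - 1)%Z.
Proof.
move=> k0 hk; have := Delta_primes_mod5 zeta_prim n_not5 k0 hk => km.
by rewrite -eqz_mod_dvd /= !modz_nat km.
Qed.

(** [t] will be the constant term of the dual element, correcting its trace to -eps K. It is an
    integer because M, N, Delta_n and the coordinate sum of beta' are 1 modulo 5, while eps = n^2
    modulo 5. *)
Lemma exists_dual_constant : exists t : int,
  5 * t = n ^+ 2 * M * (b0' + b1' + b2' + b3') - eps * K.
Proof.
have hM := mod5_nat M_gt0 M_primes; have hN := mod5_nat N_gt0 N_primes.
have hD : (5 %| lehmer_Delta n - 1)%Z by rewrite -eqz_mod_dvd; apply: Delta_mod5.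
have hb : (5 %| b0' + b1' + b2' + b3' - 1)%Z.
  apply: beta_sum_mod5.
  have -> : zlin zeta b0'%:~R b1'%:~R b2'%:~R b3'%:~R - 1%:~R =
    (N%:Z - 1)%:~R - (beta zeta - 1) * beta' zeta.
    rewrite mulrBl bb' mul1r /beta'; ring.
  apply: Zdvd_sub.
    apply: Zdvd_trans (lambda_dvd5 zeta_prim) _; exact: (int_Zdvd zeta hN).
  by apply: Zdvd_mulr => //; apply: Zzeta_zlin.
move: eps_mod hM hN hD hb => /dvdzP[qe qeE] /dvdzP[qM qME] /dvdzP[qN qNE].
move=> /dvdzP[qD qDE] /dvdzP[qb qbE].
have eE : eps = n ^+ 2 + qe * 5 by rewrite -qeE; ring.
have ME : M%:Z = 1 + qM * 5 by rewrite -qME; ring.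
have NE : N%:Z = 1 + qN * 5 by rewrite -qNE; ring.
have DE : lehmer_Delta n = 1 + qD * 5 by rewrite -qDE; ring.
have bE : b0' + b1' + b2' + b3' = 1 + qb * 5 by rewrite -qbE; ring.
exists (n ^+ 2 * (qM + qb + 5 * qM * qb) - n ^+ 2 * (qN + qD + 5 * qN * qD)
   - qe * (1 + qN * 5) * (1 + qD * 5)).
by rewrite /K eE ME NE DE bE; ring.
Qed.

(* [ad] is dual to [alpha] for the trace form: by Fourier inversion the traces
   of [iter i s alpha * iter j s ad] are [K] if [i = j] and [0] otherwise. *)
Lemma exists_dual : exists ad : L, [/\ iota ad \in Aint,
  tau 1 alpha * tau 1 ad = K%:~R &
  forall w, (exists2 k, (0 < k < 5)%N & w = zeta ^+ k) ->
    tau (w ^+ 4) alpha * tau w ad = K%:~R].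
Proof.
have [t tE] := exists_dual_constant.
(* The exponents 4, 8, 12 stand for -1, -2, -3 modulo 5, so the resolvent of this element at w is M
   beta'(w) times that of rho. Against M tau(w^4)(alpha) = beta(w) tau(w^4)(rho), the product is M
   beta beta' Delta_n = M K. *)
exists (b0'%:~R * (M%:Z%:~R * rho) + b1'%:~R * (M%:Z%:~R * iter 4 s rho)
  + b2'%:~R * (M%:Z%:~R * iter 8 s rho)
  + b3'%:~R * (M%:Z%:~R * iter 12 s rho) + t%:~R).
split.
- rewrite !rmorphD !rmorphM !rmorph_int.
  by rewrite !rpredD ?rpredM ?Aint_int //; apply: Aint_iter.
- rewrite tau1_alpha !tauD !tauZi !tau_iter ?expr1n // tau1_intr tau_one ?expr1n ?mul1r.
  have tE' := congr1 (fun t : int => t%:~R : algC) tE.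
  have -> : 5 * t%:~R = (5 * t)%:~R :> algC by rewrite rmorphM.
  rewrite tE.
  transitivity ((eps * eps)%:~R * K%:~R : algC); first by ring.
  by rewrite eps2 mulr1z mul1r.
move=> w [k k5 wE]; have wP : 5.-primitive_root w by rewrite wE; apply: zeta_prim_exp.
have w5 := prim_expr_order wP.
apply: (mulfI M0); rewrite [LHS]mulrA tau_alpha // !tauD !tauZi !tau_iter // tau_int //.
have e16 : w ^+ 4 ^+ 4 = w by rewrite -exprM -(expr_mod 16 w5).
have e32 : w ^+ 4 ^+ 8 = w ^+ 2 by rewrite -exprM -(expr_mod 32 w5).
have e48 : w ^+ 4 ^+ 12 = w ^+ 3 by rewrite -exprM -(expr_mod 48 w5).
rewrite e16 e32 e48.
transitivity (M%:R * ((beta w * beta' w) * (tau w rho * tau (w ^+ 4) rho))).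
  by rewrite /beta' /zlin; ring.
rewrite tau_prod //; have [nu nuE] := zeta_aut zeta_prim k5.
have -> : beta w * beta' w = N%:R.
  by rewrite -(rmorph_nat nu) -bb' rmorphM /beta /beta' !zlin_aut nuE -wE !rmorph_int.
by rewrite /K rmorphM.
Qed.

Lemma Zzeta5_of_Aint (D : int) y : D != 0 -> Z (D%:~R * y) -> y \in Aint -> Z (5 * y).
Proof.
move=> D0 /(ZzetaP zeta_prim)[v0 [v1 [v2 [v3 E]]]] Ay.
have DC : D%:~R != 0 :> algC by rewrite intr_eq0.
have yE : y = zlin zeta (v0%:~R / D%:~R) (v1%:~R / D%:~R) (v2%:~R / D%:~R)
    (v3%:~R / D%:~R).
  by apply: (mulfI DC); rewrite E /zlin; field.
have Q (v : int) : v%:~R / D%:~R \in Crat by rewrite rpred_div ?rpred_int.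
by rewrite yE; apply: Aint_Zzeta5 => //; rewrite -yE.
Qed.

Variable D : nat.
Hypothesis DeltaE : lehmer_Delta n = D%:Z.

Let KE : K = (N * D)%N%:Z. Proof. by rewrite /K DeltaE. Qed.

Let ND_gt0 : (0 < N * D)%N.
Proof. by have := K0; rewrite KE eqz_nat lt0n. Qed.

Let ND_primes : Delta_primes n (N * D).
Proof. by apply: Delta_primesM => // p _ pD; rewrite DeltaE dvdzE. Qed.

Let ND_mod5 : coprimez (N * D)%N 5.
Proof.
rewrite /coprimez /gcdz /= eqz_nat -/(coprime (N * D) 5) coprime_sym prime_coprime //.
by rewrite /dvdn (Delta_primes_mod5 zeta_prim n_not5 ND_gt0 ND_primes).
Qed.

Let zK j : zeta ^+ 4 ^+ 4 ^+ j = zeta ^+ j.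
Proof. by have := pow4K 1; rewrite expr1 => ->. Qed.

Lemma alpha_coord (c : nat -> rat) (y : L) :
    y = \sum_(j < 5) ratr (c j) * iter j s alpha ->
  tau (zeta ^+ 4) y = (zlin zeta (ratr (c 0%N)) (ratr (c 1%N)) (ratr (c 2%N))
      (ratr (c 3%N)) + ratr (c 4%N) * zeta ^+ 4) * tau (zeta ^+ 4) alpha /\
  tau 1 y = (\sum_(j < 5) ratr (c j)) * tau 1 alpha.
Proof.
move=> ->; split; rewrite tau_sum ?expr1n //.
- congr (_ * _); rewrite !big_ord_recl big_ord0 /= /bump /= !zK /zlin; ring.
- by rewrite exprAC z5 expr1n.
by congr (_ * _); apply: eq_bigr => j _; rewrite !expr1n mulr1.
Qed.

(** The dual element shows that the resolvents of alpha do not vanish. The one at zeta^4 then makes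
    all coefficients equal, and the trace makes their common value 0. *)
Lemma alpha_free (c : 'I_5 -> int) :
  \sum_(i < 5) iter i s alpha *~ c i = 0 -> forall i, c i = 0.
Proof.
move=> c0; pose q (j : nat) : rat := (c (inord j))%:~R.
have [ad [_ t1 tw]] := exists_dual.
have sE : 0 = \sum_(j < 5) ratr (q j) * iter j s alpha.
  rewrite -[LHS]c0; apply: eq_bigr => j _.
  by rewrite /q inord_val ratr_int mulrzl.
have tau0 z : tau z 0 = 0.
  by have := tauZi z 0 0; rewrite !mul0r.
have [] := alpha_coord sE; rewrite !tau0 => /esym/eqP E4 /esym/eqP E1.
have n4 : tau (zeta ^+ 4) alpha != 0.
  apply: contraNneq KC => h; rewrite -(tw zeta) ?h ?mul0r //.
  by exists 1%N => //; rewrite expr1.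
have n1 : tau 1 alpha != 0 by apply: contraNneq KC => h; rewrite -t1 h mul0r.
rewrite mulf_eq0 (negPf n4) orbF in E4; rewrite mulf_eq0 (negPf n1) orbF in E1.
have Q j : ratr (q j) \in Crat := Crat_rat _.
have eq4 k : (k < 4)%N -> [:: ratr (q 0%N); ratr (q 1%N); ratr (q 2%N); ratr (q 3%N)]`_k
    = ratr (q 4%N) :> algC.
  move=> k4; have [+ _] := fourier_rat zeta_prim (Q 0%N) (Q 1%N) (Q 2%N) (Q 3%N) (Q 4%N) k4.
  by apply; apply/eqP.
have q4 : ratr (q 4%N) = 0 :> algC.
  move: E1; rewrite !big_ord_recl big_ord0 /= /bump /=.
  have /= -> := eq4 0%N isT; have /= -> := eq4 1%N isT.
  have /= -> := eq4 2%N isT; have /= -> := eq4 3%N isT.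
  rewrite (_ : _ + _ = 5 * ratr (q 4%N)); last by ring.
  by rewrite mulf_eq0 pnatr_eq0 => /eqP.
have qj j : (j < 5)%N -> ratr (q j) = 0 :> algC.
  rewrite ltnS leq_eqVlt => /orP[/eqP-> //|j4].
  have := eq4 j j4; rewrite q4; by move: j j4 => [|[|[|[|]]]].
move=> i; have /eqP := qj i (ltn_ord i); rewrite /q inord_val.
by rewrite ratr_int intr_eq0 => /eqP.
Qed.

Lemma alpha_span x : iota x \in Aint ->
  exists c : 'I_5 -> int, x = \sum_(i < 5) iter i s alpha *~ c i.
Proof.
move=> Ax; have [ad [Aad t1 tw]] := exists_dual.
have Aj j : iota (x * iter j s ad) \in Aint.
  by rewrite rmorphM rpredM //; apply: Aint_iter.
have /choice[G GE] := fun j => tau1_int s5 s_fixed (Aj j).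
(* [G j] is the trace of x times the j-th conjugate of the dual element, so these are the
   coordinates of x, with denominator dividing K. *)
pose c (j : nat) : rat := (G j)%:~R / K%:~R.
have KQ : K%:~R != 0 :> rat by rewrite intr_eq0.
have cE j : ratr (c j) = (G j)%:~R / K%:~R :> algC.
  by rewrite /c fmorph_div /= !ratr_int.
have tsum z : z ^+ 5 = 1 -> tau z alpha * tau (z ^+ 4) ad = K%:~R ->
    tau z x = (\sum_(j < 5) ratr (c j) * (z ^+ 4) ^+ j) * tau z alpha.
  move=> zz zK'; apply: (mulIf KC); rewrite -{1}zK' mulrCA (tau_mul iota s5) //.
  rewrite mulrC mulrAC; congr (_ * _); rewrite mulr_suml; apply: eq_bigr => j _.
  by rewrite GE cE mulrAC divfK.
have one4 : 1 ^+ 4 = 1 :> algC by rewrite expr1n.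
have tsum1 : tau 1 x = (\sum_(j < 5) ratr (c j)) * tau 1 alpha.
  rewrite tsum ?expr1n // ?one4 //; congr (_ * _); apply: eq_bigr => j _.
  by rewrite !expr1n mulr1.
have xE : x = \sum_(j < 5) ratr (c j) * iter j s alpha.
  apply: (tau_inj zeta_prim (s := s) (iota := iota)).
    by rewrite tau_sum ?expr1n // tsum1; congr (_ * _); apply: eq_bigr => j _;
       rewrite !expr1n mulr1.
  move=> k k5; have kk : zeta ^+ k ^+ 5 = 1 by rewrite exprAC z5 expr1n.
  rewrite tau_sum // tsum //.
  have := tw (zeta ^+ k ^+ 4); rewrite pow4K; apply.
  exists (5 - k)%N; first by move: k k5 {kk} => [|[|[|[|[|]]]]].
  by move: k k5 {kk} => [|[|[|[|[|]]]]] // _; rewrite -exprM -[LHS](expr_mod _ z5).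
have [x4 x1] := alpha_coord xE.
set g := zlin _ _ _ _ _ + _ in x4.
have Zg : Z g.
  apply: (fifth_root_descent zeta_prim n_not5 Ztheta theta_free ND_gt0 ND_primes).
    have -> : (N * D)%N%:R * g = zlin zeta (G 0%N)%:~R (G 1%N)%:~R (G 2%N)%:~R
        (G 3%N)%:~R + (G 4%N)%:~R * zeta ^+ 4.
      have -> : (N * D)%N%:R = K%:~R :> algC by rewrite KE.
      by rewrite /g !cE /zlin; field.
    apply: ZzetaD; first exact: Zzeta_zlin.
    by apply: ZzetaM; [apply: Zzeta_int | apply: Zzeta_zetaX].
  rewrite -mulrA.
  have gE : g ^+ 5 * theta = tau (zeta ^+ 4) x ^+ 5.
    have := @tau_alpha_pow idfun 1%N isT; rewrite expr1 => /(_ erefl) /= tE.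
    by rewrite x4 exprMn tE.
  (* K clears the denominators of g, so K^5 clears those of g^5 theta; integrality of that number
     then reduces the denominator to 5. *)
  apply: (@Zzeta5_of_Aint (K ^+ 5)); first by rewrite expf_neq0.
    rewrite mulrA rmorphXn -exprMn; apply: ZzetaM => //; apply: ZzetaX.
    have -> : K%:~R * g = zlin zeta (G 0%N)%:~R (G 1%N)%:~R (G 2%N)%:~R
        (G 3%N)%:~R + (G 4%N)%:~R * zeta ^+ 4.
      by rewrite /g !cE /zlin; field.
    apply: ZzetaD; first exact: Zzeta_zlin.
    by apply: ZzetaM; [apply: Zzeta_int | apply: Zzeta_zetaX].
  rewrite gE rpredX //.
  have Az : zeta \in Aint := Aint_prim_root zeta_prim.
  by rewrite /resolvent /gauss !rpredD ?rpredM ?rpredX //; apply: (Aint_iter s _ Ax).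
have Q j : ratr (c j) \in Crat := Crat_rat _.
have dif k (k4 : (k < 4)%N) := coord_Zzeta zeta_prim (Q 0%N) (Q 1%N) (Q 2%N)
  (Q 3%N) (Q 4%N) k4 Zg.
(* The trace of alpha is -eps, a unit, so the coefficient sum is, up to sign, the integral trace of
   x. *)
have sum_int : \sum_(j < 5) ratr (c j) \in (Num.int : {pred algC}).
  have [t tE] := tau1_int s5 s_fixed Ax.
  have -> : \sum_(j < 5) ratr (c j) = - eps%:~R * t%:~R :> algC.
    rewrite -tE x1 tau1_alpha; move: (\sum_(_ < _) _) => S.
    transitivity ((eps * eps)%:~R * S); first by rewrite eps2 mulr1z mul1r.
    by ring.
  by rewrite rpredM ?rpredN ?intr_int.
have five_c4 : 5 * ratr (c 4%N) \in (Num.int : {pred algC}).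
  have -> : 5 * ratr (c 4%N) = \sum_(j < 5) ratr (c j) - (ratr (c 0%N) - ratr (c 4%N))
     - (ratr (c 1%N) - ratr (c 4%N)) - (ratr (c 2%N) - ratr (c 4%N))
     - (ratr (c 3%N) - ratr (c 4%N)) :> algC.
    by rewrite !big_ord_recl big_ord0 /= /bump /=; ring.
  have /= d0 := dif 0%N isT; have /= d1 := dif 1%N isT.
  have /= d2 := dif 2%N isT; have /= d3 := dif 3%N isT.
  by do 4![apply: rpredB => //].
(* Both 5 c_4 and K c_4 are integers, and K is prime to 5. *)
have c4 : ratr (c 4%N) \in (Num.int : {pred algC}).
  have [u [v uv]] := bezout_int ND_mod5.
  have uvC : u%:~R * K%:~R + v%:~R * 5 = 1 :> algC.
    transitivity ((u * K + v * 5)%:~R : algC); first by ring.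
    by rewrite KE uv.
  have -> : ratr (c 4%N) =
      u%:~R * (K%:~R * ratr (c 4%N)) + v%:~R * (5 * ratr (c 4%N)) :> algC.
    move: (ratr _) => y; transitivity ((u%:~R * K%:~R + v%:~R * 5) * y).
      by rewrite uvC mul1r.
    by ring.
  apply: rpredD; apply: rpredM => //; try exact: intr_int.
  by rewrite cE mulrC divfK // intr_int.
have cint j : (j < 5)%N -> ratr (c j) \in (Num.int : {pred algC}).
  rewrite ltnS leq_eqVlt => /orP[/eqP-> //|j4].
  rewrite -(subrK (ratr (c 4%N)) (ratr (c j))); apply: rpredD => //.
  by have := dif j j4; move: j j4 => [|[|[|[|]]]].
have ex (j : 'I_5) : exists m' : int, c j = m'%:~R.
  have := cint j (ltn_ord j); rewrite Cint_rat => /intrP[m' ->]; by exists m'.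
have /choice[C CE] := ex.
exists C; rewrite {1}xE; apply: eq_bigr => j _.
by rewrite CE ratr_int mulrzl.
Qed.

Lemma alpha_basis :
  is_Z_basis (@ring_of_integers L) (fun i : 'I_5 => iter i s alpha).
Proof.
split.
- by move=> i; apply/(iota_integral iota); exact: (Aint_iter s _ Aint_alpha).
- by move=> x /(iota_integral iota) /alpha_span.
- exact: alpha_free.
Qed.

End Basis.

(** The congruence is Euler's criterion at 5, with exponent (5 - 1) / 2 = 2. The witnesses come from
    substituting n = 5q + r. *)
Lemma legendre5 (n : int) : ~~ (5 %| n)%Z ->
  legendre n 5 * legendre n 5 = 1 /\ (5 %| legendre n 5 - n ^+ 2)%Z.
Proof.
move=> n5; have := divz_eq n 5.
have r0 : (n %% 5)%Z != 0 by apply: contraNneq n5 => /dvdz_mod0P.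
have := modz_ge0 n (isT : 5%:Z != 0); have := ltz_pmod n (isT : 0 < 5%:Z).
rewrite /legendre (negPf n5).
move: r0; set r := (n %% 5)%Z; set q := (n %/ 5)%Z => r0 r5 r0' nE.
have : r = 1 \/ r = 2 \/ r = 3 \/ r = 4 by lia.
case=> [rE|[rE|[rE|rE]]]; rewrite rE in nE.
- have -> : [exists y : 'I_5, (Posz y ^+ 2 == n %[mod 5])%Z].
    by apply/existsP; exists (@Ordinal 5 1 isT); rewrite -/r rE.
  split=> //; apply/dvdzP; exists (- (5 * q ^+ 2 + 2 * q)); rewrite nE; ring.
- have -> : [exists y : 'I_5, (Posz y ^+ 2 == n %[mod 5])%Z] = false.
    by apply/existsP => -[y]; rewrite -/r rE; case: y => [[|[|[|[|[|]]]]] ?].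
  split=> //; apply/dvdzP; exists (- (5 * q ^+ 2 + 4 * q + 1)); rewrite nE; ring.
- have -> : [exists y : 'I_5, (Posz y ^+ 2 == n %[mod 5])%Z] = false.
    by apply/existsP => -[y]; rewrite -/r rE; case: y => [[|[|[|[|[|]]]]] ?].
  split=> //; apply/dvdzP; exists (- (5 * q ^+ 2 + 6 * q + 2)); rewrite nE; ring.
- have -> : [exists y : 'I_5, (Posz y ^+ 2 == n %[mod 5])%Z].
    by apply/existsP; exists (@Ordinal 5 2 isT); rewrite -/r rE.
  split=> //; apply/dvdzP; exists (- (5 * q ^+ 2 + 8 * q + 3)); rewrite nE; ring.
Qed.

(** * Lehmer's quintic, its Galois group and the conclusion *)

Lemma lehmer_quinticE (n : int) : lehmer_quintic n =
  Poly [:: 1; n ^+ 3 + 4 * n ^+ 2 + 10 * n + 10;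
    n ^+ 4 + 5 * n ^+ 3 + 11 * n ^+ 2 + 15 * n + 5;
    - (2 * n ^+ 3 + 6 * n ^+ 2 + 10 * n + 10); n ^+ 2; 1].
Proof. by rewrite /= !cons_poly_def /lehmer_quintic; ring. Qed.

Lemma lehmer_quintic_monic n : lehmer_quintic n \is monic.
Proof. by rewrite lehmer_quinticE monicE lead_coefE (@PolyK _ 1). Qed.

Lemma lehmer_quintic_root (F : fieldType) (n : int) (x : F) :
    root (map_poly intr (lehmer_quintic n)) x -> let N : F := n%:~R in
  x ^+ 5 = - N ^+ 2 * x ^+ 4
  + (2 * N ^+ 3 + 6 * N ^+ 2 + 10 * N + 10) * x ^+ 3
  - (N ^+ 4 + 5 * N ^+ 3 + 11 * N ^+ 2 + 15 * N + 5) * x ^+ 2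
  - (N ^+ 3 + 4 * N ^+ 2 + 10 * N + 10) * x - 1.
Proof.
rewrite lehmer_quinticE rootE map_Poly horner_Poly /= => /eqP r0.
by rewrite -[LHS]subr0 -[X in _ - X]r0; ring.
Qed.

Lemma gen_fixed (L : fieldExtType rat) (rho : L) (f : {rmorphism L -> L}) :
  <<1; rho>>%VS = {:L}%VS -> f rho = rho -> f =1 id.
Proof.
move=> gen frho y; have : y \in <<1; rho>>%VS by rewrite gen memvf.
move=> /Fadjoin_polyP[q /polyOver1P[p ->] ->].
rewrite -horner_map frho -map_poly_comp; congr _.[_].
by apply: eq_map_poly => t /=; rewrite alg_num_field fmorph_rat.
Qed.

Lemma gal_iter (L : splittingFieldType rat) (sigma : gal_of {:L}) i y :
  (sigma ^+ i)%g y = iter i sigma y.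
Proof.
elim: i => [|i IH]; first by rewrite expg0 gal_id.
by rewrite expgSr galM ?memvf // IH.
Qed.

Lemma gal_fixed (L : splittingFieldType rat) (sigma : gal_of {:L}) y :
  generator 'Gal({:L} / 1) sigma -> sigma y = y -> exists q : rat, y = ratr q.
Proof.
move=> gen sy.
have gal1 : galois 1 {:L}.
  rewrite /galois sub1v normalFieldf andbT /=.
  apply/separableP => z _; apply: contraT => /separablePn_pchar[p pL _].
  by rewrite pchar_lalg pchar_num in pL.
have : y \in fixedField 'Gal({:L} / 1)%g.
  apply/fixedFieldP; first exact: memvf.
  move=> x; rewrite (eqP gen) => /cycleP[i ->].
  by rewrite gal_iter; elim: i => //= i ->.
rewrite (galois_fixedField gal1) => /vlineP[q ->].
by exists q; rewrite alg_num_field.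
Qed.

Theorem theorem3p9 (n : int) (L : splittingFieldType rat) (rho : L)
    (sigma : gal_of {:L}) (a b c d e : nat) (zeta : algC)
    (n_not5 : ~~ (5 %| n)%Z)
    (rho_root : root (map_poly intr (lehmer_quintic n)) rho)
    (L_gen : <<1; rho>>%VS = {:L}%VS)
    (sigma_gen : generator 'Gal({:L} / 1) sigma)
    (sigma_rho : sigma rho =
       (n%:~R + 2 + n%:~R * rho - rho ^+ 2) / (1 + (n%:~R + 2) * rho))
    (Delta_eq : lehmer_Delta n =
       (a * b ^ 2 * c ^ 3 * d ^ 4 * e ^ 5)%N%:Z)
    (abcde_gt0 : [&& 0 < a, 0 < b, 0 < c, 0 < d & 0 < e]%N)
    (abcd_sqfree :
       [/\ squarefree a, squarefree b, squarefree c & squarefree d])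
    (abcd_coprime : pairwise coprime [:: a; b; c; d])
    (zeta_prim : 5.-primitive_root zeta) :
  let N1 := (b * c ^ 2 * d ^ 3 * e ^ 3)%N in
  let N2 := (b * c * d ^ 2 * e ^ 2)%N in
  let N3 := (c * d * e)%N in
  [/\ forall p : nat, prime p -> (p %| N1)%N ->
        exists pi : algC, common_prime_divisor zeta p (A_ zeta n) pi,
      forall p : nat, prime p -> (p %| N2)%N ->
        exists pi : algC, common_prime_divisor zeta p (B_ zeta n) pi,
      forall p : nat, prime p -> (p %| N3)%N ->
        exists pi : algC, common_prime_divisor zeta p (C_ zeta n) pi
    & forall (k : nat) (p : 'I_k -> nat) (pi : 'I_k -> algC)
             (r : nat) (q : 'I_r -> nat) (pi' : 'I_r -> algC)
             (w : nat) (s : 'I_w -> nat) (pi'' : 'I_w -> algC)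
             (beta0 beta1 beta2 beta3 : int),
        prime_element_choice zeta N1 (A_ zeta n) p pi ->
        prime_element_choice zeta N2 (B_ zeta n) q pi' ->
        prime_element_choice zeta N3 (C_ zeta n) s pi'' ->
        let lambda1 := \prod_(i < k) pi i in
        let lambda2 := \prod_(j < r) pi' j in
        let lambda3 := \prod_(j < w) pi'' j in
        let alpha1 := u_ zeta lambda1 * lambda1 in
        let alpha2 := u_ zeta lambda2 * lambda2 in
        let alpha3 := u_ zeta lambda3 * lambda3 in
        alpha1 * alpha2 * alpha3 =
          beta0%:~R + beta1%:~R * zeta + beta2%:~R * zeta ^+ 2
            + beta3%:~R * zeta ^+ 3 ->
        let M := (b * c ^ 2 * d ^ 3 * e ^ 4)%N in
        let m : rat :=
          5^-1 * (legendre n 5 * M%:Z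
                  - n ^+ 2 * (beta0 + beta1 + beta2 + beta3))%:~R in
        m \is a Num.int /\
        normal_integral_basis_generator sigma
          (M%:R^-1 *
            (beta0%:~R * rho + beta1%:~R * sigma rho
             + beta2%:~R * (sigma ^+ 2)%g rho
             + beta3%:~R * (sigma ^+ 3)%g rho - ratr m))].
Proof.
move=> N1 N2 N3.
have N1E : N1 = (b ^ 1 * c ^ 2 * d ^ 3 * e ^ 3)%N by rewrite expn1.
have N2E : N2 = (b ^ 1 * c ^ 1 * d ^ 2 * e ^ 2)%N by rewrite !expn1.
have N3E : N3 = (b ^ 0 * c ^ 1 * d ^ 1 * e ^ 1)%N by rewrite !expn1 mul1n.
have prD i j k l : Delta_primes n (b ^ i * c ^ j * d ^ k * e ^ l).
  exact: (Delta_primes_bcde Delta_eq).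
have gtD i j k l : (0 < b ^ i * c ^ j * d ^ k * e ^ l)%N.
  exact: (bcde_gt0 abcde_gt0).
have pr1 : Delta_primes n N1 by rewrite N1E.
have pr2 : Delta_primes n N2 by rewrite N2E.
have pr3 : Delta_primes n N3 by rewrite N3E.
have BA := B_A n zeta_prim; have CA := C_A n zeta_prim.
have AA : A_ zeta n = A_ (zeta ^+ 1) n by rewrite expr1.
split.
- move=> p pp /(pr1 p pp) pD; rewrite AA.
  exact: (exists_above zeta_prim n_not5 pp pD).
- move=> p pp /(pr2 p pp) pD; rewrite BA.
  exact: (exists_above zeta_prim n_not5 pp pD).
- move=> p pp /(pr3 p pp) pD; rewrite CA.
  exact: (exists_above zeta_prim n_not5 pp pD).
move=> k p pi r q pi' w ps pi'' b0 b1 b2 b3; rewrite AA BA CA => ch1 ch2 ch3.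
move=> lambda1 lambda2 lambda3 alpha1 alpha2 alpha3 betaE M m.
have ME : M = (b ^ 1 * c ^ 2 * d ^ 3 * e ^ 4)%N by rewrite expn1.
have M0 : (0 < M)%N by rewrite ME.
have prM : Delta_primes n M by rewrite ME.
have N1_gt0 : (0 < N1)%N by rewrite N1E.
have N2_gt0 : (0 < N2)%N by rewrite N2E.
have N3_gt0 : (0 < N3)%N by rewrite N3E.
have [Za1 ma1 da1 va1] := alpha_factor zeta_prim n_not5 (isT : (0 < 1 < 5)%N) N1_gt0 pr1 ch1.
have [Za2 ma2 da2 va2] := alpha_factor zeta_prim n_not5 (isT : (0 < 3 < 5)%N) N2_gt0 pr2 ch2.
have [Za3 ma3 da3 va3] := alpha_factor zeta_prim n_not5 (isT : (0 < 2 < 5)%N) N3_gt0 pr3 ch3.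
have [theta [Ztheta tfree] thetaE] := theta_exists zeta_prim n_not5 Delta_eq
  abcde_gt0 abcd_sqfree abcd_coprime Za1 Za2 Za3 va1 va2 va3.
have betaZ : alpha1 * alpha2 * alpha3 = zlin zeta b0%:~R b1%:~R b2%:~R b3%:~R.
  exact: betaE.
rewrite -/lambda1 -/lambda2 -/lambda3 -/alpha1 -/alpha2 -/alpha3 betaZ in thetaE.
have beta_mod : Zzeta_dvd zeta (1 - zeta)
    (zlin zeta b0%:~R b1%:~R b2%:~R b3%:~R - 1).
  rewrite -betaZ.
  have -> : alpha1 * alpha2 * alpha3 - 1 = (alpha1 - 1) * (alpha2 * alpha3)
    + ((alpha2 - 1) * alpha3 + (alpha3 - 1)) by ring.
  apply: Zdvd_add; first by apply: Zdvd_mulr => //; apply: ZzetaM.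
  by apply: Zdvd_add => //; apply: Zdvd_mulr.
(* The cofactor b' of beta in N1 N2 N3 is the element beta' from which the dual element is built. *)
have [b' Zb' bb'] : Zzeta_dvd zeta (zlin zeta b0%:~R b1%:~R b2%:~R b3%:~R)
    (N1 * N2 * N3)%N%:R.
  rewrite -betaZ (natrM _ (N1 * N2) N3) (natrM _ N1 N2).
  by apply: Zdvd_mul => //; apply: Zdvd_mul.
have [b0' [b1' [b2' [b3' b'E]]]] := ZzetaP zeta_prim Zb'.
rewrite b'E in bb'.
have N_gt0 : (0 < N1 * N2 * N3)%N 
  by rewrite (muln_gt0 (N1 * N2)) (muln_gt0 N1) N1_gt0 N2_gt0.
have N_pr : Delta_primes n (N1 * N2 * N3) by apply: Delta_primesM => //; apply: Delta_primesM.
have [eps2 eps_mod] := legendre5 n_not5.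
(* M and the coordinate sum of beta are 1 modulo 5, and the Legendre symbol is n^2 modulo 5, so the
   right side vanishes modulo 5. *)
have [m0 mE] : exists m0 : int,
    5 * m0 = legendre n 5 * M%:Z - n ^+ 2 * (b0 + b1 + b2 + b3).
  have /dvdzP[qb qbE] := beta_sum_mod5 zeta_prim (x := 1) beta_mod.
  have /dvdzP[qe qeE] := eps_mod.
  have Mm := Delta_primes_mod5 zeta_prim n_not5 M0 prM.
  have M5E : M%:Z = (M %/ 5)%N%:Z * 5 + 1 by rewrite {1}(divn_eq M 5) Mm.
  have eE : legendre n 5 = n ^+ 2 + qe * 5 by rewrite -qeE; ring.
  have bE : b0 + b1 + b2 + b3 = 1 + qb * 5 by rewrite -qbE; ring.
  exists (n ^+ 2 * (M %/ 5)%N%:Z + qe * (5 * (M %/ 5)%N%:Z + 1) - n ^+ 2 * qb).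
  by rewrite M5E eE bE; ring.
have mE' : m = m0%:~R by rewrite /m -mE rmorphM /= mulKf.
split; first by rewrite mE' intr_int.
rewrite mE' ratr_int.
have [iota] := exists_embedding L_gen.
pose s : {rmorphism L -> L} := sigma.
have sN : s n%:~R = n%:~R by rewrite rmorph_int.
(* The integer n^3 + 5 n^2 + 10 n + 7 is odd for every n, hence not 0. *)
have dl0 : (n%:~R : L) ^+ 3 + 5 * n%:~R ^+ 2 + 10 * n%:~R + 7 != 0.
  pose u : int := n ^+ 3 + 5 * n ^+ 2 + 10 * n + 7.
  have -> : (n%:~R : L) ^+ 3 + 5 * n%:~R ^+ 2 + 10 * n%:~R + 7 = u%:~R.
    by rewrite /u; ring.
  rewrite -(fmorph_eq0 iota) rmorph_int intr_eq0; apply/eqP => u0.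
  have [t [i [nE i01]]] : exists t i : int, n = 2 * t + i /\ (i = 0 \/ i = 1).
    exists (n %/ 2)%Z, (n %% 2)%Z; split; first by rewrite {1}(divz_eq n 2); ring.
    have := modz_ge0 n (isT : 2%:Z != 0); have := ltz_pmod n (isT : 0 < 2%:Z).
    by move: (n %% 2)%Z => i; clear; lia.
  have [y uE] : exists y : int, u = 2 * y + 1.
    case: i01 nE => -> nE.
      by exists (4 * t ^+ 3 + 10 * t ^+ 2 + 10 * t + 3); rewrite /u nE; ring.
    by exists (4 * t ^+ 3 + 16 * t ^+ 2 + 23 * t + 11); rewrite /u nE; ring.
  by move: u0; rewrite uE; clear; lia.
have xr := lehmer_quintic_root rho_root.
have o5 := orbit5 sN xr sigma_rho dl0.
have s5 y : iter 5 s y = y.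
  have := gen_fixed (f := s \o (s \o (s \o (s \o s)))) L_gen o5 y.
  by [].
have s_fixed y : s y = y -> exists t : rat, y = ratr t := gal_fixed sigma_gen.
pose rr i := iota (iter i s rho).
have rr5 i : rr (i + 5)%N = rr i by rewrite /rr iterD s5.
have rrs : rr 0%N + rr 1%N + rr 2%N + rr 3%N + rr 4%N = - n%:~R ^+ 2.
  have := congr1 iota (orbit_sum sN xr sigma_rho dl0).
  by rewrite !rmorphD rmorphN rmorphXn /= rmorph_int.
have rrst i : rr i.+1 * (1 + (n%:~R + 2) * rr i) =
    n%:~R + 2 + n%:~R * rr i - rr i ^+ 2.
  transitivity (iota (iter i.+1 s rho * (1 + (n%:~R + 2) * iter i s rho))).
    by rewrite /rr; ring.
  by rewrite (orbit_step sN xr sigma_rho) /rr; ring.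
have rrm1 i : rr i * rr i.+1 =
    - (1 + n%:~R + n%:~R ^+ 2) + n%:~R * rr i - rr i.+1 - rr (i + 3)%N.
  rewrite /rr -rmorphM (orbit_mul1_iter sN xr sigma_rho dl0); ring.
have rrm2 i : rr i * rr i.+2 = - (1 + n%:~R) + rr i.+1 + (n%:~R + 2) * rr i.+2.
  rewrite /rr -rmorphM (orbit_mul2_iter sN xr sigma_rho dl0); ring.
have tp v (vP : 5.-primitive_root v) := gauss_pow5 vP rr5 rrs rrst rrm1 rrm2.
have Arho : iota rho \in Aint.
  apply/iota_integral; exists (lehmer_quintic n) => //.
  exact: lehmer_quintic_monic.
have t1 : resolvent s iota 1 rho = - n%:~R ^+ 2.
  by rewrite -rrs /resolvent /gauss /rr !expr1n !mulr1.
rewrite /normal_integral_basis_generator.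
set al := _^-1 * _.
have alE : M%:R * al = b0%:~R * rho + b1%:~R * iter 1 s rho
    + b2%:~R * iter 2 s rho + b3%:~R * iter 3 s rho - m0%:~R.
  have ML : M%:R != 0 :> L.
    by rewrite -(fmorph_eq0 iota) rmorph_nat pnatr_eq0 -lt0n.
  by rewrite /al mulVKf // !gal_iter.
have := alpha_basis zeta_prim n_not5 s5 s_fixed (fun v vP => (tp v vP).1)
  (fun v vP => (tp v vP).2) t1 Arho beta_mod (esym bb') M0 prM N_gt0 N_pr
  Ztheta tfree thetaE eps2 eps_mod mE alE Delta_eq.
case=> h1 h2 h3; split.
- by move=> i; rewrite gal_iter; apply: h1.
- move=> x /h2[cc ->]; exists cc; apply: eq_bigr => i _.
  by rewrite gal_iter.
move=> cc E; apply: h3; rewrite -[RHS]E; apply: eq_bigr => i _.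
by rewrite gal_iter.
Qed.
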